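(* Let $\sigma\in\mathbb{R}$ and let $L(s)=\sum_{n=0}^\infty a_n e^{-\lambda_n s}$ be a Dirichlet series that is absolutely convergent on $\operatorname{Re}(s)=\sigma$, with $a_0=1$. Then for every real $T$ and every $\delta>0$: (i) $$\int_T^{T+\delta}\log^-|L(\sigma+it)|\,dt\le \pi\left(\frac{(\log\|L\|_1+\log 2)^2}{\lambda_1}+\delta^2\lambda_1\right),$$ (ii) $$\int_T^{T+\delta}\log^+|L(\sigma+it)|\,dt\le \delta\log\|L\|_1 .$$
   Context: ''$L$ is absolutely convergent on $\operatorname{Re}(s)=\sigma$'' means: $L(s)=\sum_{n=0}^\infty a_n e^{-\lambda_n s}$ with complex coefficients $a_n$ and real exponents satisfying $0=\lambda_0<\lambda_1<\lambda_2<\cdots$, and $\|L\|_1:=\sum_{n=0}^\infty|a_n|e^{-\lambda_n\sigma}<\infty$. For $x\ge0$: $\log^+x=\max(0,\log x)$, $\log^-x=\max(0,-\log x)$. *)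

(* Defs.v *)
From mathcomp Require Import all_boot all_order all_algebra.
From mathcomp Require Import complex.
From mathcomp Require Import all_classical all_reals all_analysis.
Set Implicit Arguments.
Unset Strict Implicit.
Unset Printing Implicit Defensive.
Import Order.TTheory GRing.Theory Num.Theory.
Import numFieldNormedType.Exports.
Local Open Scope classical_set_scope.
Local Open Scope complex_scope.
Local Open Scope ring_scope.

(* At a zero of [L] the logarithm is -oo and [logm] is +oo, hence the extended
   logarithm [lne] instead of [ln], for which [ln 0 = 0]. *)
Definition logp (R : realType) (x : R) : \bar R := maxe 0%E (lne x%:E).
Definition logm (R : realType) (x : R) : \bar R := maxe 0%E (- lne x%:E)%E.

Definition expC (R : realType) (z : R[i]) : R[i] :=
  (expR (complex.Re z))%:C * (cos (complex.Im z) +i* sin (complex.Im z)).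

(* [`|z|] lives in [R[i]]; its real part is the modulus as an element of [R]. *)
Definition modC (R : realType) (z : R[i]) : R := complex.Re `|z|.

Definition dirichlet_exponents (R : realType) (lambda : nat -> R) : Prop :=
  lambda 0%N = 0 /\ (forall n, lambda n < lambda n.+1).

(* [R[i]^o] is [R[i]] with its canonical norm topology as a numFieldType. *)
Definition dirichlet_series (R : realType) (a : nat -> R[i]) (lambda : nat -> R)
    (s : R[i]) : R[i] :=
  limn (series (fun n => a n * expC (- (lambda n)%:C * s) : R[i]^o)).

Definition dirichlet_norm1 (R : realType) (a : nat -> R[i]) (lambda : nat -> R)
    (sigma : R) : \bar R :=
  (\sum_(0 <= n <oo) (modC (a n) * expR (- lambda n * sigma))%:E)%E.

Definition absolutely_convergent_on (R : realType) (a : nat -> R[i])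
    (lambda : nat -> R) (sigma : R) : Prop :=
  (dirichlet_norm1 a lambda sigma < +oo)%E.

(* Main.v *)
Require Import Defs.
From mathcomp Require Import all_boot all_order all_algebra.
From mathcomp Require Import complex.
From mathcomp Require Import all_classical all_reals all_analysis.
From mathcomp Require Import measurable_realfun.
From mathcomp Require Import ring lra.
Import Order.TTheory GRing.Theory Num.Theory.
Import numFieldNormedType.Exports.
Local Open Scope classical_set_scope.
Local Open Scope complex_scope.
Local Open Scope ring_scope.
Set Implicit Arguments.
Unset Strict Implicit.

(** Write [s = sigma + z] and [F = L / N], where [N] is the norm of [L]. The
    partial sums of [F] are exponential sums in [z] with nonnegative
    frequencies, bounded by 1 for [Re z >= 0], so (ii) is immediate:
    [|L| <= N] on the whole line.

    For (i), put [w = ln N + ln 2], [x0 = w / lambda_1], and let [z0] have real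
    part [x0] and the imaginary part of the midpoint of the segment. At [z0]
    the constant term wins: the other terms have total modulus at most
    [exp (- lambda_1 x0) (N - 1) <= 1/2], hence [|F z0| >= 1 / (2 N)]
    ([modC_F_ge]). Jensen's inequality for the half-plane bounds the Poisson
    mean of [- ln |F|] over the imaginary axis by [- ln |F z0| <= w]. Since
    [- ln |F| >= 0], and since the Poisson kernel of [z0] is at least
    [(1 / pi) x0 / (x0^2 + delta^2 / 4)] on the segment
    ([integral_le_poisson_mean]), the integral of [- ln |F|] over the segment
    is at most [pi ((x0^2 + delta^2 / 4) / x0) w], that is
    [pi (w^2 / lambda_1 + delta^2 lambda_1 / 4)]. It remains to note that
    [log^- |L| <= - ln |F|].

    Jensen's inequality is obtained without discussing zeros or holomorphic
    functions. The exponential sums with nonnegative frequencies form an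
    algebra, evaluation at [z0] is multiplicative on it, and the Poisson formula
    ([poisson_mean_Re]) says that this evaluation is the Poisson mean. The real
    parts of the algebra on the imaginary axis are closed under products
    ([is_trigM]), so every polynomial in [|F|^2] is there the real part of some
    [g] in the algebra. If [u = Re g >= 0] and [|F| exp u <= 1] on the axis,
    then the maximum principle for [F exp g] gives [|F z0| exp (mean of u) <= 1]
    ([jensen]); the exponential is replaced by [(1 + g / n)^n], which stays in
    the algebra. Now
    [- ln |F| = 1/2 sum_(k > 0) (1 - |F|^2)^k / k] has nonnegative terms, so
    its partial sums [u] satisfy the hypothesis, also at the zeros of [F]. The
    resulting bounds are uniform in the partial sums of both series, and Fatou's
    lemma passes to the limit in both at once ([integral_logm]).

    The Poisson formula itself comes down to
    [int_(- pi / 2)^(pi / 2) cos (phi - l tan x) dx = pi exp (- l) cos phi]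
    ([integral_cos_tan]): the mean of the harmonic function
    [Re exp (- l s - i phi)] over a family of circles in the right half-plane
    that starts at the point 1 and expands to the imaginary axis is constant,
    by the Cauchy-Riemann equations. *)

(** * Harmonic means over circles in the half-plane *)

(** With [s = A + i B], the two functions are the real part of
    [exp (- l s - i phi)] and the opposite of its imaginary part. *)
Lemma is_derive_expR_trig (R : realType) (l phi : R) (A B : R -> R) (x a b : R) :
  is_derive x 1 A a -> is_derive x 1 B b ->
  is_derive x 1 (fun y => expR (- (l * A y)) * cos (l * B y + phi))
    (- l * expR (- (l * A x)) *
       (a * cos (l * B x + phi) + b * sin (l * B x + phi))) /\
  is_derive x 1 (fun y => expR (- (l * A y)) * sin (l * B y + phi))
    (- l * expR (- (l * A x)) *
       (a * sin (l * B x + phi) - b * cos (l * B x + phi))).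
Proof.
move=> dA dB.
have dlA : is_derive x 1 (fun y => - (l * A y)) (- (l * a)).
  exact: (is_deriveN (is_deriveZ l dA)).
have dlB : is_derive x 1 (fun y => l * B y + phi) (l * b).
  apply: (is_derive_eq (is_deriveD (is_deriveZ l dB) (is_derive_cst phi x 1))).
  by rewrite addr0.
have dE := is_derive1_comp (is_derive_expR _) dlA.
have dC := is_derive1_comp (is_derive_cos _) dlB.
have dS := is_derive1_comp (is_derive_sin _) dlB.
split.
- apply: (is_derive_eq (is_deriveM dE dC)).
  rewrite /GRing.scale /=; ring.
- apply: (is_derive_eq (is_deriveM dE dS)).
  rewrite /GRing.scale /=; ring.
Qed.

Lemma is_derive_sqr (R : realType) (f : R -> R) (x a : R) :
  is_derive x 1 f a -> is_derive x 1 (fun y => f y ^+ 2) (2 * f x * a).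
Proof.
move=> df; apply: (is_derive_eq (is_deriveM df df)).
rewrite /GRing.scale /=; ring.
Qed.

Section Cayley.
Variable R : realType.
Implicit Types k x : R.

(** Real and imaginary parts of
    [(k cos x - i sin x) / (cos x - i k sin x)]. For [0 < k < 1] this is a
    circle around the point 1 in the right half-plane, run through once when
    [x] covers an interval of length [pi]. It shrinks to 1 for [k = 1], and
    becomes the parametrization [- i tan x] of the imaginary axis for
    [k = 0]. *)
Definition cayley_den k x := cos x ^+ 2 + k ^+ 2 * sin x ^+ 2.
Definition cayley_re k x := k / cayley_den k x.
Definition cayley_im k x := (k ^+ 2 - 1) * (cos x * sin x) / cayley_den k x.

Lemma cayley_den_ge (k0 k x : R) : 0 <= k0 <= 1 -> k0 <= k ->
  k0 ^+ 2 <= cayley_den k x.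
Proof.
move=> /andP[k00 k01] k0k; rewrite /cayley_den.
have hs : sin x ^+ 2 = 1 - cos x ^+ 2 by rewrite -(cos2Dsin2 x) addrC addKr.
have c0 : 0 <= cos x ^+ 2 := sqr_ge0 _.
have s0 : 0 <= sin x ^+ 2 := sqr_ge0 _.
have kk : k0 ^+ 2 <= k ^+ 2 by rewrite ler_sqr ?nnegrE// (le_trans k00).
have k1 : k0 ^+ 2 <= 1 by rewrite expr_le1.
have := ler_wpM2r s0 kk; have := ler_wpM2r c0 k1.
rewrite hs; nra.
Qed.

Lemma cayley_den_gt0 k x : 0 < k -> 0 < cayley_den k x.
Proof.
move=> k0; pose m := Num.min k 1.
have m0 : 0 < m by rewrite /m lt_min k0 ltr01.
apply: lt_le_trans (@cayley_den_ge m k x _ _); first by rewrite exprn_gt0.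
- by rewrite ltW//= /m ge_min lexx orbT.
- by rewrite /m ge_min lexx.
Qed.

Lemma is_derive_cayley_k k x : 0 < k ->
  is_derive k 1 (cayley_re ^~ x)
    ((cos x ^+ 2 - k ^+ 2 * sin x ^+ 2) / cayley_den k x ^+ 2) /\
  is_derive k 1 (cayley_im ^~ x)
    (2 * k * (cos x * sin x) / cayley_den k x ^+ 2).
Proof.
move=> k0; have E0 : cayley_den k x != 0 by rewrite gt_eqF ?cayley_den_gt0.
have dk2 : is_derive k 1 (fun y : R => y ^+ 2) (2 * k).
  apply: (is_derive_eq (is_derive_sqr (is_derive_id k 1))).
  rewrite /GRing.scale /=; ring.
have dk21 : is_derive k 1 (fun y : R => y ^+ 2 - 1) (2 * k).
  apply: (is_derive_eq (is_deriveD dk2 (is_derive_cst (- 1 : R) k 1))).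
  by rewrite addr0.
have dE : is_derive k 1 (cayley_den ^~ x) (2 * k * sin x ^+ 2).
  apply: (is_derive_eq (is_deriveD (is_derive_cst (cos x ^+ 2) k 1)
     (is_deriveM dk2 (is_derive_cst (sin x ^+ 2) k 1)))).
  rewrite /GRing.scale /=; ring.
have dV := @is_deriveV R (cayley_den ^~ x) k _ 1 E0 dE.
split.
- apply: (is_derive_eq (is_deriveM (is_derive_id k 1) dV)).
  rewrite /GRing.scale /= ?fctE /=.
  by move: E0; rewrite /cayley_den => E0; field; rewrite ?exprMn.
- apply: (is_derive_eq (is_deriveM (is_deriveM dk21
    (is_derive_cst (cos x * sin x : R) k 1)) dV)).
  rewrite -[X in _ = X / _]mulr1 -[X in _ = _ * X / _](cos2Dsin2 x).
  rewrite /GRing.scale /= ?fctE /=.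
  by move: E0; rewrite /cayley_den => E0; field; rewrite ?exprMn.
Qed.

(** Compared with [is_derive_cayley_k], these are the Cauchy-Riemann equations
    in the coordinates [k] and [x], up to the factor [1 - k ^+ 2]. *)
Lemma is_derive_cayley_x k x : 0 < k ->
  is_derive x 1 (cayley_re k)
    ((1 - k ^+ 2) * (2 * k * (cos x * sin x) / cayley_den k x ^+ 2)) /\
  is_derive x 1 (cayley_im k)
    ((k ^+ 2 - 1) * ((cos x ^+ 2 - k ^+ 2 * sin x ^+ 2) / cayley_den k x ^+ 2)).
Proof.
move=> k0; have E0 : cayley_den k x != 0 by rewrite gt_eqF ?cayley_den_gt0.
have dc := is_derive_cos x; have ds := is_derive_sin x.
have dE : is_derive x 1 (cayley_den k) (2 * (k ^+ 2 - 1) * (cos x * sin x)).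
  apply: (is_derive_eq (is_deriveD (is_derive_sqr dc)
     (is_deriveM (is_derive_cst (k ^+ 2) x 1) (is_derive_sqr ds)))).
  rewrite /GRing.scale /=; ring.
have dV := @is_deriveV R (cayley_den k) x _ 1 E0 dE.
split.
- apply: (is_derive_eq (is_deriveM (is_derive_cst k x 1) dV)).
  rewrite /GRing.scale /= ?fctE /=.
  by move: E0; rewrite /cayley_den => E0; field; rewrite ?exprMn.
- apply: (is_derive_eq (is_deriveM (is_deriveM
    (is_derive_cst (k ^+ 2 - 1 : R) x 1) (is_deriveM dc ds)) dV)).
  rewrite -[X in _ = _ * (X / _)]mulr1 -[X in _ = _ * (_ * X / _)](cos2Dsin2 x).
  rewrite /GRing.scale /= ?fctE /=.
  by move: E0; rewrite /cayley_den => E0; field; rewrite ?exprMn.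
Qed.
End Cayley.

Section PoissonCircle.
Variable R : realType.
Variables (l phi : R).
Hypothesis l0 : 0 <= l.
Local Notation mu := (@lebesgue_measure R).
Let J : set R := `[- (pi / 2), pi / 2]%classic.

Definition circle_re (k x : R) :=
  expR (- (l * cayley_re k x)) * cos (l * cayley_im k x + phi).
Definition circle_im (k x : R) :=
  expR (- (l * cayley_re k x)) * sin (l * cayley_im k x + phi).
(** The partial derivative of [circle_re] in [k]. *)
Definition circle_re_k (k x : R) :=
  - l * expR (- (l * cayley_re k x)) *
    ((cos x ^+ 2 - k ^+ 2 * sin x ^+ 2) / cayley_den k x ^+ 2
       * cos (l * cayley_im k x + phi)
     + 2 * k * (cos x * sin x) / cayley_den k x ^+ 2
       * sin (l * cayley_im k x + phi)).

Lemma is_derive_circle_re_k (k x : R) : 0 < k ->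
  is_derive k 1 (circle_re ^~ x) (circle_re_k k x).
Proof.
by move=> k0; have [dA dB] := is_derive_cayley_k x k0;
  exact: (is_derive_expR_trig l phi dA dB).1.
Qed.

Lemma is_derive_circle_im_x (k x : R) : 0 < k ->
  is_derive x 1 (circle_im k) ((1 - k ^+ 2) * circle_re_k k x).
Proof.
move=> k0; have [dA dB] := is_derive_cayley_x x k0.
apply: (is_derive_eq (is_derive_expR_trig l phi dA dB).2).
rewrite /circle_re_k; ring.
Qed.

Lemma is_derive_circle_re_x (k x : R) : 0 < k ->
  {d | is_derive x 1 (circle_re k) d}.
Proof.
move=> k0; have [dA dB] := is_derive_cayley_x x k0.
by eexists; exact: (is_derive_expR_trig l phi dA dB).1.
Qed.

Lemma is_derive_continuous (f : R -> R) (x a : R) :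
  is_derive x 1 f a -> {for x, continuous f}.
Proof. by move=> df; apply/differentiable_continuous/derivable1_diffP. Qed.

Lemma continuous_circle_re (k : R) : 0 < k -> continuous (circle_re k).
Proof.
move=> k0 x; have [d dd] := is_derive_circle_re_x x k0.
exact: is_derive_continuous dd.
Qed.

Lemma continuous_cayley_den (k : R) : continuous (cayley_den k).
Proof.
move=> x; apply: (@continuousD _ _ _ (fun y => cos y ^+ 2)).
  exact: is_derive_continuous (is_derive_sqr (is_derive_cos x)).
apply: (@continuousM _ _ (fun=> k ^+ 2)); first exact: cst_continuous.
exact: is_derive_continuous (is_derive_sqr (is_derive_sin x)).
Qed.

Lemma continuous_circle_re_k (k : R) : 0 < k -> continuous (circle_re_k k).
Proof.
move=> k0 x.
have E0 : cayley_den k x != 0 by rewrite gt_eqF ?cayley_den_gt0.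
have [dA dB] := is_derive_cayley_x x k0.
have cc := @continuous_cos R x; have cs := @continuous_sin R x.
have cc2 : {for x, continuous (fun y : R => cos y ^+ 2)}.
  exact: is_derive_continuous (is_derive_sqr (is_derive_cos x)).
have cs2 : {for x, continuous (fun y : R => sin y ^+ 2)}.
  exact: is_derive_continuous (is_derive_sqr (is_derive_sin x)).
have cE : {for x, continuous (fun y => (cayley_den k y ^+ 2)^-1)}.
  apply: (@continuousV _ _ (fun y => cayley_den k y ^+ 2)).
    by rewrite sqrf_eq0.
  by apply: (@continuousM _ _ (cayley_den k)); exact: continuous_cayley_den.
have [dC dS] := is_derive_expR_trig l phi dA dB.
pose C y := expR (- (l * cayley_re k y)) * cos (l * cayley_im k y + phi).
pose S y := expR (- (l * cayley_re k y)) * sin (l * cayley_im k y + phi).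
have cC : {for x, continuous C} := is_derive_continuous dC.
have cS : {for x, continuous S} := is_derive_continuous dS.
rewrite (_ : circle_re_k k = fun y => - l * 
  ((cos y ^+ 2 - k ^+ 2 * sin y ^+ 2) * (cayley_den k y ^+ 2)^-1 * C y +
   2 * k * (cos y * sin y) * (cayley_den k y ^+ 2)^-1 * S y)); last first.
  by apply/funext => y; rewrite /circle_re_k /C /S; ring.
apply: cvgM; first exact: cvg_cst.
apply: cvgD; (apply: cvgM; last by []); (apply: cvgM; last by []).
  by apply: cvgB => //; apply: cvgM => //; exact: cvg_cst.
by apply: cvgM; [exact: cvg_cst|exact: cvgM].
Qed.

Lemma continuous_integrable_pi (f : R -> R) :
  continuous f -> mu.-integrable J (EFin \o f).
Proof.
move=> cf; apply: continuous_compact_integrable; first exact: segment_compact.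
exact: continuous_subspaceT.
Qed.

Lemma npihalf_lt : - (pi / 2) < pi / 2 :> R.
Proof. by have := pi_gt0 R; lra. Qed.

(** By the Cauchy-Riemann equations the integrand is, up to the factor
    [1 - k ^+ 2], the derivative in [x] of [circle_im], which takes the same
    value at both ends because the circle closes up. *)
Lemma integral_circle_re_k (k : R) : 0 < k < 1 ->
  \int[mu]_(x in J) circle_re_k k x = 0.
Proof.
move=> /andP[k0 k1].
have cR := continuous_circle_re_k k0.
have kk : 1 - k ^+ 2 != 0 by rewrite gt_eqF // subr_gt0 expr_lt1 // ltW.
have dI x := is_derive_circle_im_x x k0.
suff : (1 - k ^+ 2) * \int[mu]_(x in J) circle_re_k k x = 0.
  by move/eqP; rewrite mulf_eq0 (negbTE kk) /= => /eqP.
rewrite -RintegralZl //; last exact: continuous_integrable_pi.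
rewrite /Rintegral.
rewrite (@continuous_FTC2 R (fun x => (1 - k ^+ 2) * circle_re_k k x)
  (circle_im k)).
- rewrite -EFinB /= /circle_im /cayley_im /cayley_re /cayley_den.
  by rewrite cosN cos_pihalf sinN sin_pihalf sqrrN !mul0r !mulr0 !mul0r subrr.
- exact: npihalf_lt.
- apply: continuous_subspaceT => x; apply: cvgM; first exact: cvg_cst.
  exact: cR.
- split=> [x _||].
  + by have [] := dI x.
  + by apply: cvg_at_right_filter; exact: is_derive_continuous (dI _).
  + by apply: cvg_at_left_filter; exact: is_derive_continuous (dI _).
- by move=> x _; rewrite derive1E; have [] := dI x.
exact: measurable_itv.
Qed.

(** The domination that allows differentiating under the integral sign, locally
    uniformly in [k > 0]. *)
Lemma circle_re_k_bound (k0 k x : R) : 0 < k0 <= 1 -> k0 <= k -> k <= 2 ->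
  `|circle_re_k k x| <= l * (5 / (k0 ^+ 2) ^+ 2 + 4 / (k0 ^+ 2) ^+ 2).
Proof.
move=> /andP[k00 k01] k0k k2.
have kgt0 : 0 < k := lt_le_trans k00 k0k.
have m0 : 0 < k0 ^+ 2 by rewrite exprn_gt0.
have mE : k0 ^+ 2 <= cayley_den k x by apply: cayley_den_ge => //; rewrite ltW.
have E0 : 0 < cayley_den k x by apply: cayley_den_gt0.
have iE : (cayley_den k x ^+ 2)^-1 <= ((k0 ^+ 2) ^+ 2)^-1.
  rewrite lef_pV2 ?posrE ?exprn_gt0 // ler_sqr ?nnegrE //; exact: ltW.
have iE0 : 0 <= (cayley_den k x ^+ 2)^-1 by rewrite invr_ge0 sqr_ge0.
have hs2 : sin x ^+ 2 = 1 - cos x ^+ 2 by rewrite -(cos2Dsin2 x) addrC addKr.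
have c0 : 0 <= cos x ^+ 2 := sqr_ge0 _.
have s0 : 0 <= sin x ^+ 2 := sqr_ge0 _.
have hA : `|cos x ^+ 2 - k ^+ 2 * sin x ^+ 2| <= 5.
  have k4 : k ^+ 2 <= 4 by nra.
  have := sqr_ge0 k; rewrite ler_norml => ?; apply/andP; split; nra.
have hB : `|2 * k * (cos x * sin x)| <= 4.
  rewrite normrM [`|cos x * _|]normrM ger0_norm; last by rewrite mulr_ge0 // ltW.
  have := cos_max x; have := sin_max x.
  move: (normr_ge0 (cos x)) (normr_ge0 (sin x)).
  move: `|cos x| `|sin x| => c s c' s' s1 c1.
  have : c * s <= 1 by nra.
  have : 0 <= c * s by nra.
  by move: (c * s) => cs; nra.
rewrite /circle_re_k !normrM normrN (ger0_norm l0) (ger0_norm (expR_ge0 _)) -mulrA.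
apply: ler_wpM2l => //.
apply: le_trans (_ : 1 * _ <= _).
  apply: ler_wpM2r => //.
  by rewrite expR_le1 oppr_le0 mulr_ge0 // /cayley_re divr_ge0 // ltW.
rewrite mul1r; apply: le_trans (ler_normD _ _) _; apply: lerD;
  rewrite !normrM -[leRHS]mulr1; apply: ler_pM; rewrite ?mulr_ge0 //.
- rewrite (ger0_norm iE0); exact: ler_pM.
- exact: cos_max.
- rewrite (ger0_norm iE0); apply: ler_pM => //.
  by rewrite -!normrM.
- exact: sin_max.
Qed.

(** The mean over the circle is constant in [k], and for [k = 1] the circle is
    the point 1. *)
Lemma circle_mean (k : R) : 0 < k < 1 ->
  \int[mu]_(x in J) circle_re k x = pi * (expR (- l) * cos phi).
Proof.
move=> /andP[k0 k1].
pose F k' := \int[mu]_(x in J) circle_re k' x.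
have kh0 : 0 < k / 2 by rewrite divr_gt0.
have mJ : measurable J by exact: measurable_itv.
(* The interval from [k / 2] to 2 contains [k] and 1 in its interior and stays
   away from the singular value 0. *)
pose M : R := l * (5 / ((k / 2) ^+ 2) ^+ 2 + 4 / ((k / 2) ^+ 2) ^+ 2).
have M0 : 0 <= M by rewrite mulr_ge0 // addr_ge0 // divr_ge0 // sqr_ge0.
have intf x : `](k / 2), 2[%classic x -> mu.-integrable J (EFin \o circle_re x).
  rewrite /= in_itv /= => /andP[x1 _]; apply: continuous_integrable_pi.
  by apply: continuous_circle_re; lra.
have derf x y : `](k / 2), 2[%classic x -> J y -> derivable (circle_re ^~ y) x 1.
  rewrite /= in_itv /= => /andP[x1 _] _.
  by have [] := @is_derive_circle_re_k x y _; first lra.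
have intM : mu.-integrable J (EFin \o (fun=> M)).
  by apply: continuous_integrable_pi; exact: cst_continuous.
have d1E c y : `](k / 2), 2[%classic c ->
    partial1of2 circle_re c y = circle_re_k c y.
  rewrite /= in_itv /= => /andP[x1 _]; rewrite partial1of2E.
  by have [] := @is_derive_circle_re_k c y _; first lra.
have ubM x y : `](k / 2), 2[%classic x -> J y -> `|partial1of2 circle_re x y| <= M.
  move=> Ix _; rewrite d1E //; move: Ix; rewrite /= in_itv /= => /andP[x1 x2].
  by apply: circle_re_k_bound; lra.
have dF c : k / 2 < c < 2 -> derivable F c 1.
  move=> hc; apply: (@derivable_under_integral R _ _ mu circle_re J mJ c (k / 2) 2
    _ intf derf (fun=> M) (fun=> M0) intM ubM).
  by rewrite /= in_itv.
have F'0 c : c \in `]k, 1[ -> derive1 F c = 0.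
  rewrite in_itv /= => hc.
  have Ic : `](k / 2), 2[%classic c by rewrite /= in_itv /=; lra.
  rewrite (@differentiation_under_integral R _ _ mu circle_re J mJ c (k / 2) 2
    Ic intf derf (fun=> M) (fun=> M0) intM ubM).
  under eq_Rintegral do rewrite d1E //.
  by apply: integral_circle_re_k; lra.
have [c ck] : exists2 c, c \in `]k, 1[ & F 1 - F k = 0 * (1 - k).
  apply: (@MVT _ F (fun=> 0)) => //.
  - move=> c ck; apply: DeriveDef; last by rewrite -derive1E F'0.
    by apply: dF; move: ck; rewrite in_itv /=; lra.
  - apply: derivable_within_continuous => c; rewrite in_itv /= => ck.
    by apply: dF; lra.
rewrite mul0r => /eqP; rewrite subr_eq0 => /eqP Fk; rewrite -[LHS]/(F k) -Fk.
rewrite /F.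
under eq_Rintegral do [rewrite /circle_re /cayley_re /cayley_im /cayley_den;
  rewrite expr1n subrr !mul1r cos2Dsin2 invr1 mulr1 !mul0r mulr0 add0r].
rewrite Rintegral_cst //= lebesgue_measure_itv /= lte_fin npihalf_lt /=.
rewrite mulrC; congr (_ * _); lra.
Qed.

End PoissonCircle.

(** * The Poisson formula on the imaginary axis *)
Section PoissonAxis.
Variable R : realType.
Local Notation mu := (@lebesgue_measure R).
Local Notation D := (`]- (pi / 2), pi / 2[%classic : set R).

Lemma cos_neq0_pihalf (x : R) : D x -> cos x != 0.
Proof. by rewrite /= in_itv /= => hx; rewrite gt_eqF // cos_gt0_pihalf. Qed.

Lemma measurable_fun_tan (u : R -> R) (x0 t0 : R) : continuous u ->
  measurable_fun D (fun x => u (t0 + x0 * tan x)).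
Proof.
move=> cu; apply: open_continuous_measurable_fun; first exact: interval_open.
move=> x /set_mem Dx; apply: continuous_comp; last exact: cu.
apply: cvgD; first exact: cvg_cst.
apply: cvgM; first exact: cvg_cst.
exact/continuous_tan/cos_neq0_pihalf.
Qed.

Lemma integrable_tan (u : R -> R) (x0 t0 M : R) : continuous u ->
  (forall t, `|u t| <= M) ->
  mu.-integrable D (fun x => (u (t0 + x0 * tan x))%:E).
Proof.
move=> cu uM; apply: measurable_bounded_integrable.
- exact: measurable_itv.
- by rewrite /= lebesgue_measure_itv /= lte_fin npihalf_lt -EFinB ltry.
- exact: measurable_fun_tan.
- exists M; split; first exact: num_real.
  by move=> y My x _ /=; apply: le_trans (uM _) (ltW My).
Qed.

Lemma circle_re_cvg (l phi x : R) (k : nat -> R) : cos x != 0 ->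
  k @ \oo --> (0 : R) ->
  (fun n => circle_re l phi (k n) x) @ \oo --> cos (phi - l * tan x).
Proof.
move=> cx k0.
have k2 : (fun n => k n ^+ 2) @ \oo --> (0 : R).
  rewrite -[X in _ --> X](mulr0 0); exact: cvgM.
have cE : (fun n => cayley_den (k n) x) @ \oo --> cos x ^+ 2.
  rewrite -[X in _ --> X]addr0 -[X in _ --> _ + X](mul0r (sin x ^+ 2)).
  by apply: cvgD; [exact: cvg_cst|apply: cvgM => //; exact: cvg_cst].
have cV : (fun n => (cayley_den (k n) x)^-1) @ \oo --> (cos x ^+ 2)^-1.
  by apply: cvgV => //; rewrite sqrf_eq0.
have cA : (fun n => cayley_re (k n) x) @ \oo --> (0 : R).
  by rewrite -[X in _ --> X](mul0r (cos x ^+ 2)^-1); exact: cvgM.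
have cB : (fun n => cayley_im (k n) x) @ \oo --> - tan x.
  have -> : - tan x = (0 - 1) * (cos x * sin x) / (cos x ^+ 2).
    by rewrite /tan; field.
  apply: cvgM => //; apply: cvgM; last exact: cvg_cst.
  by apply: cvgB => //; exact: cvg_cst.
have -> : cos (phi - l * tan x) =
    expR (- (l * 0)) * cos (l * (- tan x) + phi).
  by rewrite mulr0 oppr0 expR0 mul1r mulrN addrC.
have h1 : {for 0, continuous (fun y : R => expR (- (l * y)))}.
  apply: (@continuous_comp _ _ _ (fun y => - (l * y)) expR).
    by apply: cvgN; apply: cvgM => //; exact: cvg_cst.
  exact: continuous_expR.
have h2 : {for - tan x, continuous (fun y : R => cos (l * y + phi))}.
  apply: (@continuous_comp _ _ _ (fun y => l * y + phi) cos).
    by apply: cvgD; [apply: cvgM => //; exact: cvg_cst|exact: cvg_cst].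
  exact: continuous_cos.
by apply: cvgM; [exact: cvg_comp cA h1|exact: cvg_comp cB h2].
Qed.

(** The limit of [circle_mean] for [k] tending to 0, by dominated convergence;
    the integrands are bounded by 1 because the circles lie in the right
    half-plane. The open interval keeps away from the poles of [tan]. *)
Lemma integral_cos_tan (l phi : R) : 0 <= l ->
  \int[mu]_(x in D) cos (phi - l * tan x) = pi * (expR (- l) * cos phi).
Proof.
move=> l0.
pose k n : R := n.+2%:R^-1.
have kn n : 0 < k n < 1.
  by rewrite /k invr_gt0 ltr0n /= invf_lt1 ?ltr0n // ltr1n.
have k_cvg : k @ \oo --> (0 : R).
  rewrite (_ : k = fun n => harmonic (n + 1)%N); last first.
    by apply/funext => n; rewrite /k /harmonic /= addn1.
  by rewrite (@cvg_shiftn 1); exact: cvg_harmonic.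
have mD : measurable D by exact: measurable_itv.
have iD n : mu.-integrable D (fun x => (circle_re l phi (k n) x)%:E).
  have [kn0 _] := andP (kn n).
  have := continuous_integrable_pi (@continuous_circle_re _ l phi _ kn0).
  by apply: integrableS => //; exact: subset_itv_oo_cc.
have cphi : continuous (fun t : R => cos (phi - l * t)).
  move=> t; apply: (@continuous_comp _ _ _ (fun y => phi - l * y) cos).
    apply: cvgB; first exact: cvg_cst.
    by apply: cvgM => //; exact: cvg_cst.
  exact: continuous_cos.
have mlim : mu.-integrable D (fun x => (cos (phi - l * tan x))%:E).
  have := @integrable_tan _ 1 0 1 cphi (fun t => cos_max _).
  by congr integrable; apply/funext => x; rewrite add0r mul1r.
have [] := @dominated_convergence _ _ _ mu D mD
  (fun n x => (circle_re l phi (k n) x)%:E) (fun x => (cos (phi - l * tan x))%:E)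
  (fun=> 1%:E).
- by move=> n; exact: measurable_int (iD n).
- exact: measurable_int mlim.
- apply: aeW => x Dx; apply: cvg_EFin; first exact: nearW.
  exact: circle_re_cvg (cos_neq0_pihalf Dx) k_cvg.
- have := @integrable_tan (fun=> 1) 1 0 1 (@cst_continuous _ _ _) (fun t => _).
  by apply; rewrite normr1.
- apply: aeW => x n Dx; rewrite lee_fin /circle_re normrM (ger0_norm (expR_ge0 _)).
  rewrite -[leRHS]mulr1; apply: ler_pM => //; last exact: cos_max.
  rewrite expR_le1 oppr_le0 mulr_ge0 // /cayley_re divr_ge0 //.
    by have := kn n; lra.
  by rewrite ltW // cayley_den_gt0 //; have := kn n; lra.
move=> _ _ lim.
have e n : (\int[mu]_(x in D) (circle_re l phi (k n) x)%:E)%E =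
    (pi * (expR (- l) * cos phi))%:E.
  have [kn0 _] := andP (kn n).
  rewrite -(circle_mean phi l0 (kn n)) /Rintegral fineK; last first.
    apply: integrable_fin_num => //.
    exact: continuous_integrable_pi (@continuous_circle_re _ l phi _ kn0).
  by apply/esym/integral_itv_bndoo; exact: measurable_int (iD n).
rewrite /Rintegral.
suff -> : (\int[mu]_(x in D) (cos (phi - l * tan x))%:E)%E =
    (pi * (expR (- l) * cos phi))%:E by [].
move: lim; rewrite (_ : [sequence _]_n = fun=> (pi * (expR (- l) * cos phi))%:E).
  by move=> lim; apply: (cvg_unique _ lim (cvg_cst _)).
exact/funext.
Qed.

End PoissonAxis.

(** * Modulus and complex exponential *)
Section Modulus.
Variable R : realType.
Implicit Types z w : R[i].

Lemma modCE z : modC z = Num.sqrt (complex.Re z ^+ 2 + complex.Im z ^+ 2).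
Proof. by case: z => a b; rewrite /modC normc_def. Qed.

Lemma modC_norm z : (modC z)%:C = `|z|.
Proof. by case: z => a b; rewrite /modC normc_def. Qed.

Lemma modC_ge0 z : 0 <= modC z.
Proof. by rewrite modCE sqrtr_ge0. Qed.

Lemma modC_sqr z : modC z ^+ 2 = complex.Re z ^+ 2 + complex.Im z ^+ 2.
Proof. by rewrite modCE sqr_sqrtr // addr_ge0 // sqr_ge0. Qed.

Lemma modCM z w : modC (z * w) = modC z * modC w.
Proof. by apply: complexI; rewrite rmorphM /= !modC_norm normrM. Qed.

Lemma modCX z n : modC (z ^+ n) = modC z ^+ n.
Proof. by apply: complexI; rewrite rmorphXn /= !modC_norm normrX. Qed.

Lemma modCD z w : modC (z + w) <= modC z + modC w.
Proof. by have := ler_normD z w; rewrite -!modC_norm -rmorphD /= lecR. Qed.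

Lemma modCB z w : modC z - modC w <= modC (z + w).
Proof.
have := ler_normD (z + w) (- w).
by rewrite addrK normrN -!modC_norm -rmorphD /= lecR lerBlDr.
Qed.

Lemma modCN z : modC (- z) = modC z.
Proof. by rewrite /modC normrN. Qed.

Lemma modC_real (x : R) : 0 <= x -> modC x%:C = x.
Proof. by move=> x0; rewrite modCE /= expr0n addr0 sqrtr_sqr ger0_norm. Qed.

Lemma modC0 : modC (0 : R[i]) = 0.
Proof. by rewrite /modC normr0. Qed.

Lemma modC1 : modC (1 : R[i]) = 1.
Proof. by rewrite /modC normr1. Qed.

Lemma ler_Re_modC z : `|complex.Re z| <= modC z.
Proof.
rewrite modCE -sqrtr_sqr ler_wsqrtr // lerDl; exact: sqr_ge0.
Qed.

Lemma ler_Im_modC z : `|complex.Im z| <= modC z.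
Proof.
rewrite modCE -sqrtr_sqr ler_wsqrtr // lerDr; exact: sqr_ge0.
Qed.

Lemma modC_sum (I : Type) (r : seq I) (P : pred I) (F : I -> R[i]) :
  modC (\sum_(i <- r | P i) F i) <= \sum_(i <- r | P i) modC (F i).
Proof.
elim/big_ind2: _ => [|x1 x2 y1 y2 h1 h2|//]; first by rewrite modC0.
by apply: le_trans (modCD _ _) _; exact: lerD.
Qed.

Lemma ReD z w : complex.Re (z + w) = complex.Re z + complex.Re w.
Proof. by case: z w => [a b] [c d]. Qed.

Lemma Re_sum (I : Type) (r : seq I) (F : I -> R[i]) :
  complex.Re (\sum_(i <- r) F i) = \sum_(i <- r) complex.Re (F i).
Proof. by elim/big_rec2: _ => // i x y _ <-; rewrite ReD. Qed.

Lemma ImD z w : complex.Im (z + w) = complex.Im z + complex.Im w.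
Proof. by case: z w => [a b] [c d]. Qed.

Lemma Im_sum (I : Type) (r : seq I) (F : I -> R[i]) :
  complex.Im (\sum_(i <- r) F i) = \sum_(i <- r) complex.Im (F i).
Proof. by elim/big_rec2: _ => // i x y _ <-; rewrite ImD. Qed.

Lemma expCD z w : expC (z + w) = expC z * expC w.
Proof.
case: z w => [a b] [c d]; rewrite /expC /= expRD cosD sinD.
apply/eqP; rewrite eq_complex /=; apply/andP; split; apply/eqP; ring.
Qed.

Lemma modC_expC z : modC (expC z) = expR (complex.Re z).
Proof.
case: z => a b; rewrite /expC /= modCM modC_real ?expR_ge0 //.
by rewrite modCE /= cos2Dsin2 sqrtr1 mulr1.
Qed.
End Modulus.

(** * Exponential sums and their real parts *)
Section ExpSum.
Variable R : realType.
Implicit Types (h g : R[i] -> R[i]) (u v : R -> R) (l : seq (R[i] * R)).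

Definition expsum l (s : R[i]) : R[i] :=
  \sum_(p <- l) p.1 * expC (- p.2%:C * s).

(** Nonnegative frequencies make the sum bounded for [Re s >= 0], and are what
    the Poisson formula requires. *)
Definition is_expsum h :=
  exists2 l, all (fun p => 0 <= p.2) l & h =1 expsum l.

Lemma is_expsum_cst c : is_expsum (fun=> c).
Proof.
exists [:: (c, 0)] => [|s]; first by rewrite /= lexx.
rewrite /expsum big_seq1 /= (_ : (0 : R)%:C = 0) // oppr0 mul0r.
rewrite /expC /= expR0 cos0 sin0.
by rewrite mul1r mulr1.
Qed.

Lemma is_expsum_monomial c (x : R) : 0 <= x ->
  is_expsum (fun s => c * expC (- x%:C * s)).
Proof.
by move=> x0; exists [:: (c, x)] => [|s]; rewrite /= ?x0 // /expsum big_seq1.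
Qed.

Lemma is_expsumD h g : is_expsum h -> is_expsum g ->
  is_expsum (fun s => h s + g s).
Proof.
move=> [l l0 hl] [m m0 gm]; exists (l ++ m) => [|s]; first by rewrite all_cat l0.
by rewrite hl gm /expsum big_cat.
Qed.

Lemma is_expsumM h g : is_expsum h -> is_expsum g ->
  is_expsum (fun s => h s * g s).
Proof.
move=> [l l0 hl] [m m0 gm].
exists [seq (p.1 * q.1, p.2 + q.2) | p <- l, q <- m] => [|s].
  apply/allP => p /allpairsP [[q r] /= [ql rm ->]] /=.
  by apply: addr_ge0; [exact: (allP l0)|exact: (allP m0)].
rewrite hl gm /expsum big_allpairs_dep big_distrlr /=.
apply: eq_bigr => p _; apply: eq_bigr => q _.
rewrite rmorphD /= opprD mulrDl expCD; ring.
Qed.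

Lemma is_expsumX h n : is_expsum h -> is_expsum (fun s => h s ^+ n).
Proof.
move=> hh; elim: n => [|n IH]; first exact: is_expsum_cst.
have [l l0 hl] := is_expsumM hh IH; exists l => // s.
by rewrite -hl exprS.
Qed.

Lemma is_expsum_bounded h : is_expsum h ->
  exists M, forall t : R, modC (h (0 +i* t)) <= M.
Proof.
move=> [l l0 hl]; exists (\sum_(p <- l) modC p.1) => t.
rewrite hl; apply: le_trans (modC_sum _ _ _) _.
apply: ler_sum => p _; rewrite modCM modC_expC /=.
by rewrite mulr0 sub0r oppr0 mul0r oppr0 expR0 mulr1.
Qed.

Lemma Re_monomial (c : R[i]) (x t : R) :
  complex.Re (c * expC (- x%:C * (0 +i* t))) =
  complex.Re c * cos (x * t) + complex.Im c * sin (x * t).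
Proof.
case: c => a b; rewrite /expC /=.
rewrite !(mulr0, mul0r, oppr0, subr0, addr0, add0r) expR0 !mulNr cosN sinN.
ring.
Qed.

(** The real parts of exponential sums on the imaginary axis. These are all
    real trigonometric sums, as the real part of a term with negative frequency
    is that of its conjugate. *)
Definition is_trig u :=
  exists2 h, is_expsum h & forall t, u t = complex.Re (h (0 +i* t)).

Lemma is_trig_ext u v : u =1 v -> is_trig u -> is_trig v.
Proof. by move=> uv [h hh uh]; exists h => // t; rewrite -uv. Qed.

Lemma is_trig_cst c : is_trig (fun=> c).
Proof. by exists (fun=> c%:C) => //; exact: is_expsum_cst. Qed.

Lemma is_trigD u v : is_trig u -> is_trig v -> is_trig (fun t => u t + v t).
Proof.
move=> [h hh uh] [g gg vg]; exists (fun s => h s + g s) => [|t].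
  exact: is_expsumD.
by rewrite uh vg ReD.
Qed.

Lemma is_trigZ c u : is_trig u -> is_trig (fun t => c * u t).
Proof.
move=> [h hh uh]; exists (fun s => c%:C * h s) => [|t].
  by apply: is_expsumM => //; exact: is_expsum_cst.
by rewrite uh; case: (h _) => a b /=; rewrite mul0r subr0.
Qed.

Lemma is_trig_sum (I : Type) (r : seq I) (F : I -> R -> R) :
  (forall i, is_trig (F i)) -> is_trig (fun t => \sum_(i <- r) F i t).
Proof.
move=> hF; elim: r => [|i r IH].
  by apply: is_trig_ext (is_trig_cst 0) => t; rewrite big_nil.
apply: is_trig_ext (is_trigD (hF i) IH) => t; by rewrite big_cons.
Qed.

Lemma is_trig_ReIm h : is_expsum h ->
  is_trig (fun t => complex.Re (h (0 +i* t))) /\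
  is_trig (fun t => complex.Im (h (0 +i* t))).
Proof.
move=> hh; split; first by exists h.
exists (fun s => (0 +i* (-1)) * h s).
  by apply: is_expsumM => //; exact: is_expsum_cst.
by move=> t; case: (h _) => a b /=; ring.
Qed.

(** [Re z * Re w] is half of [Re (z w) + Re (z w')], with [w'] the conjugate of
    [w]. The frequency of [z w'] is [x - y]; hence the order between the
    frequencies. *)
Lemma is_trigM_monomial (a b c d : R) (x y : R) : 0 <= y <= x ->
  is_trig (fun t => (a * cos (x * t) + b * sin (x * t)) *
                    (c * cos (y * t) + d * sin (y * t))).
Proof.
move=> /andP[y0 yx].
pose z : R[i] := (a +i* b); pose w : R[i] := (c +i* d).
have x0 : 0 <= x := le_trans y0 yx.
have h1 : is_expsum (fun s => ((2^-1)%:C * (z * w)) * expC (- (x + y)%:C * s)).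
  by apply: is_expsum_monomial; exact: addr_ge0.
have h2 : is_expsum (fun s => ((2^-1)%:C * (z * (c +i* (- d))))
                              * expC (- (x - y)%:C * s)).
  by apply: is_expsum_monomial; rewrite subr_ge0.
eexists; first exact: is_expsumD h1 h2.
move=> t; rewrite ReD !Re_monomial /=.
rewrite [(x - y) * t]mulrBl [(x + y) * t]mulrDl cosB cosD sinB sinD.
by field.
Qed.

Lemma is_trigM u v : is_trig u -> is_trig v -> is_trig (fun t => u t * v t).
Proof.
move=> [h [l l0 hl] uh] [g [m m0 gm] vg].
pose F (p q : R[i] * R) (t : R) :=
  complex.Re (p.1 * expC (- (p.2)%:C * (0 +i* t))) *
  complex.Re (q.1 * expC (- (q.2)%:C * (0 +i* t))).
have hF p q : 0 <= p.2 -> 0 <= q.2 -> is_trig (F p q).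
  move=> p0 q0; have [pq|qp] := leP p.2 q.2.
    apply: is_trig_ext (@is_trigM_monomial (complex.Re q.1) (complex.Im q.1)
      (complex.Re p.1) (complex.Im p.1) q.2 p.2 _); last by rewrite p0.
    by move=> t; rewrite /F !Re_monomial mulrC.
  apply: is_trig_ext (@is_trigM_monomial (complex.Re p.1) (complex.Im p.1)
      (complex.Re q.1) (complex.Im q.1) p.2 q.2 _); last by rewrite q0 ltW.
  by move=> t; rewrite /F !Re_monomial.
(* [is_trig_sum] wants every summand in the class, so the pairs that do not occur
   in the lists get the value 0. *)
pose G p q := if (0 <= p.2) && (0 <= q.2) then F p q else fun=> 0.
have hG p q : is_trig (G p q).
  rewrite /G; case: ifPn => [/andP[p0 q0]|_]; [exact: hF|exact: is_trig_cst].
apply: is_trig_ext (is_trig_sum l (fun p => is_trig_sum m (hG p))) => t.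
rewrite uh vg hl gm /expsum !Re_sum big_distrlr /=.
apply: eq_big_seq => p pl; apply: eq_big_seq => q qm.
by rewrite /G (allP l0 _ pl) (allP m0 _ qm).
Qed.

Lemma is_trigX u n : is_trig u -> is_trig (fun t => u t ^+ n).
Proof.
move=> hu; elim: n => [|n IH]; first exact: is_trig_cst.
by apply: is_trig_ext (is_trigM hu IH) => t; rewrite exprS.
Qed.

Lemma is_trig_modC_sqr h : is_expsum h ->
  is_trig (fun t => modC (h (0 +i* t)) ^+ 2).
Proof.
move=> /is_trig_ReIm [hr hi].
by apply: is_trig_ext (is_trigD (is_trigX 2 hr) (is_trigX 2 hi)) => t;
  rewrite modC_sqr.
Qed.

Lemma is_trig_bounded u : is_trig u -> exists M, forall t, `|u t| <= M.
Proof.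
move=> [h /is_expsum_bounded [M hM] uh]; exists M => t.
by rewrite uh; exact: le_trans (ler_Re_modC _) (hM t).
Qed.

Lemma is_trig_continuous u : is_trig u -> continuous u.
Proof.
move=> [h [l _ hl] uh].
have -> : u = fun t => \sum_(p <- l)
   (complex.Re p.1 * cos (p.2 * t) + complex.Im p.1 * sin (p.2 * t)).
  apply/funext => t; rewrite uh hl /expsum Re_sum.
  by apply: eq_bigr => p _; rewrite Re_monomial.
elim: l {hl} => [|p l IH] t.
  rewrite (_ : (fun _ => _) = fun=> 0); first exact: cst_continuous.
  by apply/funext => x; rewrite big_nil.
rewrite (_ : (fun _ => _) = fun x => (complex.Re p.1 * cos (p.2 * x) +
   complex.Im p.1 * sin (p.2 * x)) + \sum_(p <- l)
   (complex.Re p.1 * cos (p.2 * x) + complex.Im p.1 * sin (p.2 * x))); last first.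
  by apply/funext => x; rewrite big_cons.
have cl : {for t, continuous (fun x : R => p.2 * x)}.
  by apply: cvgM => //; exact: cvg_cst.
apply: cvgD; last exact: IH.
apply: cvgD; (apply: cvgM; first exact: cvg_cst).
  by apply: (@continuous_comp _ _ _ _ cos) => //; exact: continuous_cos.
by apply: (@continuous_comp _ _ _ _ sin) => //; exact: continuous_sin.
Qed.

End ExpSum.

(** * Poisson means *)
Section Mean.
Variables (R : realType) (x0 t0 : R).
Hypothesis x0_ge0 : 0 <= x0.
Local Notation mu := (@lebesgue_measure R).
Local Notation D := (`]- (pi / 2), pi / 2[%classic : set R).
Implicit Types u v : R -> R.

(** The Poisson integral at [x0 + i t0] of a function on the imaginary axis: the
    substitution [t = t0 + x0 tan x] turns the Poisson kernel into the constant
    [1 / pi] on a bounded interval. *)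
Definition poisson_mean u : R :=
  pi^-1 * \int[mu]_(x in D) u (t0 + x0 * tan x).

Let mD : measurable D.
Proof. exact: measurable_itv. Qed.

Lemma is_trig_integrable u : is_trig u ->
  mu.-integrable D (EFin \o (fun x => u (t0 + x0 * tan x))).
Proof.
move=> hu; have [M hM] := is_trig_bounded hu.
exact: integrable_tan (is_trig_continuous hu) hM.
Qed.

Lemma poisson_meanD u v : is_trig u -> is_trig v ->
  poisson_mean (fun t => u t + v t) = poisson_mean u + poisson_mean v.
Proof.
move=> hu hv; rewrite /poisson_mean -mulrDr RintegralD //;
  exact: is_trig_integrable.
Qed.

Lemma poisson_mean_le u v : is_trig u -> is_trig v -> (forall t, u t <= v t) ->
  poisson_mean u <= poisson_mean v.
Proof.
move=> hu hv uv; apply: ler_wpM2l; first by rewrite invr_ge0 pi_ge0.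
by apply: le_Rintegral => //; exact: is_trig_integrable.
Qed.

Lemma poisson_mean_cst c : poisson_mean (fun=> c) = c.
Proof.
rewrite /poisson_mean Rintegral_cst //= lebesgue_measure_itv /= lte_fin npihalf_lt.
have p0 : pi != 0 :> R by rewrite gt_eqF ?pi_gt0.
rewrite -EFinD /= opprK; move: (@pi R) p0 => p p0; by field.
Qed.

Lemma poisson_mean_monomial (c : R[i]) (x : R) : 0 <= x ->
  poisson_mean (fun t => complex.Re (c * expC (- x%:C * (0 +i* t)))) =
  complex.Re (c * expC (- x%:C * (x0 +i* t0))).
Proof.
move=> hx; have xx0 : 0 <= x * x0 by exact: mulr_ge0.
have icos phi : mu.-integrable D
    (EFin \o (fun t => cos (phi - (x * x0) * tan t))).
  have cu : continuous (fun t : R => cos (phi - (x * x0) * t)).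
    move=> t; apply: (@continuous_comp _ _ _ (fun y => phi - (x * x0) * y) cos).
      apply: cvgB; first exact: cvg_cst.
      by apply: cvgM => //; exact: cvg_cst.
    exact: continuous_cos.
  have := @integrable_tan _ _ 1 0 1 cu (fun t => cos_max _).
  by congr integrable; apply/funext => t; rewrite /= add0r mul1r.
have Zint (r : R) (f : R -> R) : mu.-integrable D (EFin \o f) ->
    mu.-integrable D (EFin \o (fun t => r * f t)).
  move=> fi; have : mu.-integrable D (fun t => r%:E * (EFin \o f) t)%E.
    exact: integrableZl.
  by [].
(* [cos (x t)] and [sin (x t)] at [t = t0 + x0 tan x], in the form that
   [integral_cos_tan] evaluates. *)
pose f1 t := cos (- (x * t0) - (x * x0) * tan t).
pose f2 t := cos (pi / 2 - x * t0 - (x * x0) * tan t).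
have i1 : mu.-integrable D (EFin \o f1) := icos _.
have i2 : mu.-integrable D (EFin \o f2) := icos _.
transitivity (pi^-1 * \int[mu]_(t in D)
    (complex.Re c * f1 t + complex.Im c * f2 t)).
  congr (_ * _); apply: eq_Rintegral => t _; rewrite Re_monomial /f1 /f2.
  have -> : pi / 2 - x * t0 - x * x0 * tan t = pi / 2 - x * (t0 + x0 * tan t).
    by ring.
  have -> : - (x * t0) - x * x0 * tan t = - (x * (t0 + x0 * tan t)) by ring.
  by rewrite cosN cosB cos_pihalf sin_pihalf mul0r add0r mul1r.
rewrite RintegralD //; last 2 first.
- exact: Zint i1.
- exact: Zint i2.
rewrite !RintegralZl // !integral_cos_tan // cosN.
have -> : cos (pi / 2 - x * t0) = sin (x * t0).
  by rewrite cosB cos_pihalf sin_pihalf mul0r add0r mul1r.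
case: c => a b; rewrite /expC /=.
rewrite !(mulr0, mul0r, oppr0, subr0, addr0, add0r) !mulNr cosN sinN.
have p0 : pi != 0 :> R by rewrite gt_eqF ?pi_gt0.
by move: (@pi R) p0 => p p0; field.
Qed.

Lemma poisson_mean_Re h : is_expsum h ->
  poisson_mean (fun t => complex.Re (h (0 +i* t))) = complex.Re (h (x0 +i* t0)).
Proof.
move=> [l l0 hl]; rewrite hl.
have -> : (fun t => complex.Re (h (0 +i* t))) =
          (fun t => complex.Re (expsum l (0 +i* t))).
  by apply/funext => t; rewrite hl.
elim: l l0 {hl} => [_|p l IH /andP[p0 l0]].
  rewrite /expsum big_nil; under eq_fun do rewrite big_nil.
  exact: poisson_mean_cst.
rewrite {2}/expsum big_cons ReD -IH // -poisson_mean_monomial // -poisson_meanD.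
- by congr poisson_mean; apply/funext => t; rewrite /expsum big_cons ReD.
- by eexists; first exact: (is_expsum_monomial p.1 p0).
- by exists (expsum l) => //; exists l.
Qed.

(** Multiplying by the conjugate of the value at the interior point makes this
    value real and positive, and reduces the claim to the monotonicity of the
    mean of the real part. *)
Lemma max_modulus h M : is_expsum h -> (forall t, modC (h (0 +i* t)) <= M) ->
  modC (h (x0 +i* t0)) <= M.
Proof.
move=> hh hM; set z := h _.
have [z0|z0] := eqVneq (modC z) 0.
  by rewrite z0; apply: le_trans (hM 0); exact: modC_ge0.
have zp : 0 < modC z by rewrite lt_neqAle eq_sym z0 modC_ge0.
pose w := z^*%C.
have hw : is_expsum (fun s => w * h s).
  by apply: is_expsumM => //; exact: is_expsum_cst.
have mw : modC w = modC z.
  by rewrite !modCE /w; case: (z) => a b /=; rewrite sqrrN.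
have := poisson_mean_le (is_trig_ReIm hw).1 (is_trig_cst (modC z * M)).
rewrite (poisson_mean_Re hw) poisson_mean_cst -/z.
have -> : complex.Re (w * z) = modC z ^+ 2.
  by rewrite modC_sqr /w; case: (z) => a b /=; ring.
rewrite expr2 ler_pM2l //; apply => t.
apply: le_trans (ler_norm _) _; apply: le_trans (ler_Re_modC _) _.
by rewrite modCM mw ler_pM2l.
Qed.

End Mean.

(** * Jensen's inequality in the half-plane *)
Lemma le1_of_expR_small (R : realType) (y K : R) :
  (forall n : nat, y <= expR (K / n.+1%:R)) -> y <= 1.
Proof.
move=> h.
have c : (fun n => expR (K / n.+1%:R)) @ \oo --> expR (K * 0).
  have cK : (fun n => K * harmonic n) @ \oo --> K * 0.
    by apply: cvgM; [exact: cvg_cst|exact: cvg_harmonic].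
  have cE : {for K * 0, continuous (@expR R)} by exact: continuous_expR.
  exact: (@cvg_comp _ _ _ _ (@expR R) _ _ _ cK cE).
move: c; rewrite mulr0 expR0 => c; rewrite -(cvg_lim (@Rhausdorff R) c).
apply: limr_ge.
  by apply/cvg_ex; exists 1.
by apply: nearW => n; exact: h.
Qed.

Lemma expR_le_1D (R : realType) (r N : R) : 0 <= r -> 0 < N ->
  expR (r / (N + r)) <= 1 + r / N.
Proof.
move=> r0 N0; have Nr : 0 < N + r by rewrite ltr_pwDl.
have p0 : 0 < 1 + r / N by rewrite ltr_pwDl // divr_ge0 // ltW.
have := expR_ge1Dx (- (r / (N + r))); rewrite expRN.
have -> : 1 - r / (N + r) = (1 + r / N)^-1.
  by field; rewrite !lt0r_neq0.
by rewrite lef_pV2 // posrE expR_gt0.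
Qed.

(** A quantitative form of the convergence of [(1 + r / n) ^+ n] to [expR r]. *)
Lemma expR_pow_lower (R : realType) (r : R) (n : nat) : 0 <= r ->
  expR r <= (1 + r / n.+1%:R) ^+ n.+1 * expR (r ^+ 2 / n.+1%:R).
Proof.
move=> r0; have : 0 < n.+1%:R :> R by rewrite ltr0n.
have := @expRM_natl R n.+1; move: (n.+1%:R) => N expN N0.
have p0 : 0 < 1 + r / N by rewrite ltr_pwDl // divr_ge0 // ltW.
have Nr : 0 < N + r by rewrite ltr_pwDl.
have -> : expR r = expR (r / (N + r)) ^+ n.+1 * expR (r ^+ 2 / (N + r)).
  by rewrite -expN -expRD; congr expR; field; exact: lt0r_neq0.
apply: ler_pM; rewrite ?exprn_ge0 ?expR_ge0 //.
  apply: lerXn2r; rewrite ?nnegrE ?expR_ge0 //; first exact: ltW.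
  exact: expR_le_1D.
rewrite ler_expR; apply: ler_wpM2l; first exact: sqr_ge0.
by rewrite lef_pV2 ?posrE // lerDl.
Qed.

Lemma modC_1D_le (R : realType) (z : R[i]) (x M : R) : 0 < x -> modC z <= M ->
  modC (1 + (x^-1)%:C * z) <= expR (complex.Re z / x + M ^+ 2 / x ^+ 2 / 2).
Proof.
move=> x0 zM; rewrite -ler_sqr ?nnegrE ?modC_ge0 ?expR_ge0 // -expRM_natl.
apply: le_trans (expR_ge1Dx _).
have -> : 1 + 2 * (complex.Re z / x + M ^+ 2 / x ^+ 2 / 2) =
  1 + 2 * (complex.Re z / x) + M ^+ 2 / x ^+ 2 by field; exact: lt0r_neq0.
have -> : modC (1 + x^-1%:C * z) ^+ 2 =
    1 + 2 * (complex.Re z / x) + modC z ^+ 2 / x ^+ 2.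
  rewrite !modC_sqr; case: z {zM} => a b /=.
  by field; exact: lt0r_neq0.
rewrite lerD2l ler_wpM2r ?invr_ge0 ?sqr_ge0 // ler_sqr ?nnegrE ?modC_ge0 //.
exact: le_trans (modC_ge0 _) zM.
Qed.

Section Jensen.
Variables (R : realType) (x0 t0 : R).
Hypothesis x0_ge0 : 0 <= x0.

(** If [u] is the real part of [g], then [F exp g] is bounded by 1 on the
    imaginary axis, hence at the interior point, where [g] has real part the
    mean of [u]. The proof uses [F (1 + g / n)^n], which is an exponential sum
    and costs a factor that tends to 1. *)
Lemma jensen (F : R[i] -> R[i]) (u : R -> R) :
  is_expsum F -> is_trig u -> (forall t, 0 <= u t) ->
  (forall t, modC (F (0 +i* t)) * expR (u t) <= 1) ->
  modC (F (x0 +i* t0)) * expR (poisson_mean x0 t0 u) <= 1.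
Proof.
move=> hF hu u0 Fu; have [g hg ug] := hu.
have mg : poisson_mean x0 t0 u = complex.Re (g (x0 +i* t0)).
  rewrite -(poisson_mean_Re t0 x0_ge0 hg); congr poisson_mean; exact/funext.
have [M hM] := is_expsum_bounded hg.
set r := poisson_mean x0 t0 u in mg *.
have r0 : 0 <= r.
  have := @poisson_mean_le _ x0 t0 _ _ (is_trig_cst 0) hu u0.
  by rewrite poisson_mean_cst.
apply: (@le1_of_expR_small _ _ (M ^+ 2 / 2 + r ^+ 2)) => n.
set N : R := n.+1%:R.
have N0 : 0 < N by rewrite ltr0n.
pose h s := F s * (1 + N^-1%:C * g s) ^+ n.+1.
have hh : is_expsum h.
  apply: is_expsumM => //; apply: is_expsumX; apply: is_expsumD.
    exact: is_expsum_cst.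
  by apply: is_expsumM => //; exact: is_expsum_cst.
have hle t : modC (h (0 +i* t)) <= expR (M ^+ 2 / 2 / N).
  rewrite /h modCM modCX.
  apply: le_trans (_ : modC (F (0 +i* t)) *
     expR (u t / N + M ^+ 2 / N ^+ 2 / 2) ^+ n.+1 <= _).
    apply: ler_wpM2l; first exact: modC_ge0.
    apply: lerXn2r; rewrite ?nnegrE ?modC_ge0 ?expR_ge0 // ug.
    exact: modC_1D_le.
  rewrite -expRM_natl -/N.
  have -> : N * (u t / N + M ^+ 2 / N ^+ 2 / 2) = u t + M ^+ 2 / 2 / N.
    by field; exact: lt0r_neq0.
  by rewrite expRD mulrA ler_piMl ?expR_ge0.
have := max_modulus t0 x0_ge0 hh hle.
rewrite /h modCM modCX => hmax.
rewrite mulrDl expRD.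
apply: le_trans (ler_wpM2r (expR_ge0 _) hmax).
rewrite -[leRHS]mulrA; apply: ler_wpM2l; first exact: modC_ge0.
apply: le_trans (expR_pow_lower n r0) _; apply: ler_wpM2r; first exact: expR_ge0.
apply: lerXn2r; rewrite ?nnegrE ?modC_ge0 //.
  by rewrite addr_ge0 // divr_ge0 // ltW.
apply: le_trans (ler_Re_modC _); apply: le_trans (ler_norm _).
rewrite -/N mg; case: (g _) => a b /=; rewrite mul0r subr0.
by rewrite mulrC.
Qed.
End Jensen.

(** * Partial sums of the logarithmic series *)
Section LogSeries.
Variable R : realType.
Implicit Types v : R.

Definition log_series (K : nat) v := \sum_(k < K) v ^+ k.+1 / k.+1%:R.

Lemma log_series_ge0 K v : 0 <= v -> 0 <= log_series K v.
Proof.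
by move=> v0; apply: sumr_ge0 => k _; rewrite divr_ge0 // exprn_ge0.
Qed.

Lemma log_series_nd (K K' : nat) v : 0 <= v -> (K <= K')%N ->
  log_series K v <= log_series K' v.
Proof.
move=> v0 /subnKC <-; elim: (K' - K)%N => [|n IH]; first by rewrite addn0.
apply: le_trans IH _; rewrite addnS /log_series [leRHS]big_ord_recr /=.
by rewrite lerDl divr_ge0 // exprn_ge0.
Qed.

Lemma is_derive_log_series K v : v != 1 ->
  is_derive v 1 (log_series K) ((1 - v ^+ K) / (1 - v)).
Proof.
move=> v1; have v10 : 1 - v != 0 by rewrite subr_eq0 eq_sym.
elim: K => [|K IH].
  rewrite (_ : log_series 0 = cst 0); last first.
    by apply/funext => x; rewrite /log_series big_ord0.
  apply: (is_derive_eq (is_derive_cst (0 : R) v 1)).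
  by rewrite expr0 subrr mul0r.
have dX : is_derive v 1 (fun y : R => y ^+ K.+1) (K.+1%:R * v ^+ K).
  apply: DeriveDef; first exact: exprn_derivable.
  by rewrite exp_derive /GRing.scale /= mulr1.
have dK := is_deriveM dX (is_derive_cst (K.+1%:R^-1 : R) v 1).
rewrite (_ : log_series K.+1 = fun x => log_series K x + x ^+ K.+1 / K.+1%:R);
  last by apply/funext => x; rewrite /log_series big_ord_recr.
apply: (is_derive_eq (is_deriveD IH dK)).
rewrite /GRing.scale /= mulr0 add0r exprS.
have : K.+1%:R != 0 :> R by rewrite pnatr_eq0.
by move: (K.+1%:R : R) => k k0; field; rewrite ?k0 ?v10.
Qed.

(** The derivative of the middle term is [- v ^+ K / (1 - v)]; both bounds
    follow from the mean value theorem. *)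
Lemma log_series_ln K v : 0 <= v < 1 ->
  - (v ^+ K / (1 - v)) <= log_series K v + ln (1 - v) <= 0.
Proof.
move=> /andP[v0 v1].
have d (x : R) : x < 1 -> is_derive x 1 (fun y => log_series K y + ln (1 - y))
    (- (x ^+ K / (1 - x))).
  move=> x1.
  have dS := @is_derive_log_series K x (negbT (lt_eqF x1)).
  have d1 : is_derive x 1 (fun y : R => 1 - y) (- 1).
    apply: (is_derive_eq (is_deriveD (is_derive_cst (1 : R) x 1)
      (is_deriveNid x 1))).
    by rewrite add0r.
  have x10 : 0 < 1 - x by rewrite subr_gt0.
  have dL := @is_derive1_comp R (@ln R) (fun y => 1 - y) x _ _
    (is_derive1_ln x10) d1.
  apply: (is_derive_eq (is_deriveD dS dL)).
  rewrite /GRing.scale /=; field; exact: lt0r_neq0.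
have [||c] := @MVT_segment R (fun y => log_series K y + ln (1 - y))
   (fun x => - (x ^+ K / (1 - x))) 0 v v0.
- by move=> x; rewrite in_itv /= => xv; apply: d; lra.
- apply: derivable_within_continuous => x; rewrite in_itv /= => xv.
  by have [] := @d x _; first lra.
rewrite in_itv /= => /andP[c0 cv].
have -> : log_series K 0 = 0.
  by rewrite /log_series big1 // => k _; rewrite expr0n mul0r.
rewrite !subr0 ln1 addr0 subr0 => ->.
have c1 : 0 < 1 - c by lra.
have v10 : 0 < 1 - v by lra.
have cK0 : 0 <= c ^+ K / (1 - c) by rewrite divr_ge0 ?exprn_ge0 // ltW.
rewrite mulNr oppr_le0 mulr_ge0 // andbT lerN2.
apply: le_trans (_ : c ^+ K / (1 - c) * 1 <= _).
  by apply: ler_wpM2l => //; exact: ltW.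
rewrite mulr1; apply: ler_pM; rewrite ?exprn_ge0 ?invr_ge0 ?(ltW c1) //.
  by apply: lerXn2r; rewrite ?nnegrE.
by rewrite lef_pV2 ?posrE //; lra.
Qed.

(** Partial sums stay below [- ln (1 - v)]. Multiplied out, this remains
    meaningful for [v = 1], the value reached at the zeros of a function. *)
Lemma log_series_expR K v : 0 <= v <= 1 -> (1 - v) * expR (log_series K v) <= 1.
Proof.
move=> /andP[v0]; rewrite le_eqVlt => /predU1P[->|v1].
  by rewrite subrr mul0r.
have v01 : 0 <= v < 1 by rewrite v0.
have /andP[_ h] := log_series_ln K v01.
have v10 : 0 < 1 - v by lra.
by rewrite -{1}(lnK v10) -expRD expR_le1 addrC.
Qed.

(** For [v = 1] the partial sums are those of the harmonic series, which are
    unbounded. *)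
Lemma log_series_bounded v r : 0 <= v <= 1 ->
  (forall K, log_series K v <= r) -> v < 1 /\ - ln (1 - v) <= r.
Proof.
move=> /andP[v0]; rewrite le_eqVlt => /predU1P[->|v1] h.
  exfalso; apply: (@dvg_harmonic R); apply: nondecreasing_is_cvgn.
    apply/nondecreasing_seqP => n; rewrite /series /= big_nat_recr //= lerDl.
    by rewrite invr_ge0.
  exists r => _ [n _ <-]; apply: le_trans (h n).
  rewrite /series /= big_mkord /log_series le_eqVlt; apply/orP; left; apply/eqP.
  by apply: eq_bigr => k _; rewrite expr1n mul1r.
split=> //; have v10 : 0 < 1 - v by lra.
have c : (fun n => r + v ^+ n / (1 - v)) @ \oo --> r + 0 / (1 - v).
  apply: cvgD; first exact: cvg_cst.
  apply: cvgM; last exact: cvg_cst.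
  by apply: cvg_expr; rewrite ger0_norm.
suff : - ln (1 - v) <= r + 0 / (1 - v) by rewrite mul0r addr0.
rewrite -(cvg_lim (@Rhausdorff R) c); apply: limr_ge.
  by apply/cvg_ex; eexists; exact: c.
have v01 : 0 <= v < 1 by rewrite v0.
by apply: nearW => n; have /andP[hn _] := log_series_ln n v01; have := h n; lra.
Qed.

Lemma continuous_log_series K : continuous (log_series K).
Proof.
elim: K => [|K IH] v.
  rewrite (_ : log_series 0 = fun=> 0); first exact: cst_continuous.
  by apply/funext => x; rewrite /log_series big_ord0.
rewrite (_ : log_series K.+1 = fun x => log_series K x + x ^+ K.+1 / K.+1%:R).
  apply: cvgD; first exact: IH.
  by apply: cvgM; [exact: exprn_continuous|exact: cvg_cst].
by apply/funext => x; rewrite /log_series big_ord_recr.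
Qed.

Lemma is_trig_log_series (u : R -> R) K : is_trig u ->
  is_trig (fun t => log_series K (u t)).
Proof.
move=> hu; apply: is_trig_sum => k.
by apply: is_trig_ext (is_trigZ k.+1%:R^-1 (is_trigX k.+1 hu)) => t; rewrite mulrC.
Qed.
End LogSeries.

(** * The Poisson kernel on a segment *)
Section Kernel.
Variables (R : realType) (x0 T delta : R).
Hypotheses (x0_gt0 : 0 < x0) (delta_gt0 : 0 < delta).
Local Notation mu := (@lebesgue_measure R).
Local Notation D := (`]- (pi / 2), pi / 2[%classic : set R).
Let t0 := T + delta / 2.
(** [phi] is the inverse of the substitution in [poisson_mean], and its derivative
   [k] is [pi] times the Poisson kernel. *)
Let phi (t : R) := atan ((t - t0) / x0).
Let k (t : R) := x0 / (x0 ^+ 2 + (t - t0) ^+ 2).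

Lemma kernel_den_gt0 t : 0 < x0 ^+ 2 + (t - t0) ^+ 2.
Proof. by rewrite ltr_pwDl ?exprn_gt0 // sqr_ge0. Qed.

Lemma is_derive_phi (t : R) : is_derive t 1 phi (k t).
Proof.
have d1 : is_derive t 1 (fun y : R => (y - t0) / x0) (x0^-1).
  have d0 := is_deriveD (is_derive_id t 1) (is_derive_cst (- t0) t 1).
  apply: (is_derive_eq (is_deriveM d0 (is_derive_cst (x0^-1 : R) t 1))).
  by rewrite /GRing.scale /= mulr0 add0r addr0 mulr1.
apply: (is_derive_eq (@is_derive1_comp R (@atan R) (fun y => (y - t0) / x0)
  t _ _ (is_derive1_atan _) d1)).
rewrite /GRing.scale /= /k.
have x1 := lt0r_neq0 x0_gt0; have k1 := lt0r_neq0 (kernel_den_gt0 t).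
by field; rewrite k1 x1.
Qed.

Lemma continuous_k : continuous k.
Proof.
move=> t; apply: cvgM; first exact: cvg_cst.
apply: cvgV; first by rewrite lt0r_neq0 // kernel_den_gt0.
apply: cvgD; first exact: cvg_cst.
by apply: cvgM; apply: cvgB => //; exact: cvg_cst.
Qed.

(** [t0] is the midpoint of the segment, so the kernel is smallest at the two
    endpoints, at distance [delta / 2]. As [u >= 0], the part of the mean that
    lies over the segment is a lower bound for the whole mean. *)
Lemma integral_le_poisson_mean (u : R -> R) : is_trig u -> (forall t, 0 <= u t) ->
  (\int[mu]_(t in `[T, (T + delta)%R]) (u t)%:E <=
   (pi * ((x0 ^+ 2 + delta ^+ 2 / 4) / x0) * poisson_mean x0 t0 u)%:E)%E.
Proof.
move=> hu u0; have cu := is_trig_continuous hu.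
pose C := x0 / (x0 ^+ 2 + delta ^+ 2 / 4).
have den0 : 0 < x0 ^+ 2 + delta ^+ 2 / 4.
  by rewrite ltr_pwDl ?exprn_gt0 // divr_ge0 // sqr_ge0.
have C0 : 0 < C by rewrite divr_gt0.
pose G x := u (t0 + x0 * tan x).
have iG := is_trig_integrable x0 t0 hu.
have pT : phi T <= phi (T + delta).
  by apply: le_atan; rewrite ler_pM2r ?invr_gt0 // lerD2r lerDl ltW.
have sub : `[phi T, phi (T + delta)]%classic `<=` D.
  move=> x /=; rewrite !in_itv /= => /andP[h1 h2].
  by rewrite (lt_le_trans (atan_gtNpi2 _) h1) (le_lt_trans h2 (atan_ltpi2 _)).
have Gphi t : G (phi t) = u t.
  rewrite /G /phi atanK; congr u; field; exact: lt0r_neq0.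
have dphi t : derivable phi t 1 by have [] := is_derive_phi t.
have d1phi : derive1 phi = k.
  by apply/funext => t; rewrite derive1E; have [] := is_derive_phi t.
have subst : (\int[mu]_(x in `[phi T, phi (T + delta)]) (G x)%:E =
   \int[mu]_(t in `[T, (T + delta)%R]) (u t * k t)%:E)%E.
  rewrite integration_by_substitution_increasing.
  - apply: eq_integral => t _ /=; congr EFin.
    by rewrite /= -d1phi -[in RHS]Gphi.
  - by rewrite lerDl ltW.
  - move=> x y _ _ xy; apply: lt_atan.
    by rewrite ltr_pM2r ?invr_gt0 // ltrD2r.
  - by move=> x _; rewrite d1phi; exact: continuous_k.
  - rewrite d1phi; apply/cvg_ex; exists (k T).
    by apply: cvg_at_right_filter; exact: continuous_k.
  - rewrite d1phi; apply/cvg_ex; exists (k (T + delta)).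
    by apply: cvg_at_left_filter; exact: continuous_k.
  - split=> [x _||] //.
    + apply: cvg_at_right_filter; exact: is_derive_continuous (is_derive_phi _).
    + apply: cvg_at_left_filter; exact: is_derive_continuous (is_derive_phi _).
  - apply: continuous_in_subspaceT => x /set_mem /sub Dx.
    apply: continuous_comp; last exact: cu.
    apply: cvgD; first exact: cvg_cst.
    apply: cvgM; first exact: cvg_cst.
    exact/continuous_tan/cos_neq0_pihalf.
have mI : measurable (`[T, T + delta]%classic : set R) by exact: measurable_itv.
have mcont (f : R -> R) : continuous f ->
    measurable_fun (`[T, T + delta]%classic : set R) (EFin \o f).
  move=> cf; apply/measurable_EFinP; apply: measurable_funTS.
  exact: continuous_measurable_fun.
have step : (C%:E * \int[mu]_(t in `[T, (T + delta)%R]) (u t)%:E <=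
    (pi * poisson_mean x0 t0 u)%:E)%E.
  rewrite -ge0_integralZl //; last 3 first.
  - exact: mcont.
  - by move=> t _; rewrite lee_fin.
  - by rewrite lee_fin ltW.
  apply: le_trans (_ : \int[mu]_(t in `[T, (T + delta)%R]) (u t * k t)%:E <= _)%E.
    apply: ge0_le_integral => //.
    - by move=> t _; rewrite -EFinM lee_fin mulr_ge0 // ltW.
    - have := @mcont (fun t => C * u t) _; apply.
      by move=> t; apply: cvgM; [exact: cvg_cst|exact: cu].
    - have := @mcont (fun t => u t * k t) _; apply.
      by move=> t; apply: cvgM; [exact: cu|exact: continuous_k].
    - move=> t; rewrite /= in_itv /= => /andP[t1 t2].
      rewrite -EFinM lee_fin mulrC; apply: ler_wpM2l => //.
      rewrite /C /k; apply: ler_wpM2l; first exact: ltW.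
      rewrite lef_pV2 ?posrE ?kernel_den_gt0 // lerD2l /t0.
      have h1 : - (delta / 2) <= t - (T + delta / 2) by lra.
      have h2 : t - (T + delta / 2) <= delta / 2 by lra.
      by nra.
  rewrite -subst /poisson_mean mulrA divff ?mul1r; last first.
    by rewrite lt0r_neq0 ?pi_gt0.
  rewrite /Rintegral fineK; last by apply: integrable_fin_num.
  apply: ge0_subset_integral => //.
  - exact: measurable_int iG.
  - by move=> x _; rewrite lee_fin; exact: u0.
have -> : pi * ((x0 ^+ 2 + delta ^+ 2 / 4) / x0) * poisson_mean x0 t0 u =
    C^-1 * (pi * poisson_mean x0 t0 u).
  by rewrite /C invf_div mulrAC mulrC mulrA.
rewrite EFinM; apply: le_trans (lee_wpmul2l _ step); last first.
  by rewrite lee_fin invr_ge0 ltW.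
by rewrite muleA -EFinM mulVf ?mul1e // lt0r_neq0.
Qed.
End Kernel.

Lemma is_trig_log_series_modC (R : realType) (F : R[i] -> R[i]) (K : nat) :
  is_expsum F ->
  is_trig (fun t => 2^-1 * log_series K (1 - modC (F (0 +i* t)) ^+ 2)).
Proof.
move=> hF; apply: is_trigZ; apply: is_trig_log_series.
apply: is_trig_ext (is_trigD (is_trig_cst 1) (is_trigZ (-1) (is_trig_modC_sqr hF))).
by move=> t; rewrite mulN1r.
Qed.

(** Half a partial sum of the logarithmic series at [1 - |F|^2] approximates
    [- ln |F|] from below, so that [jensen] applies to it. *)
Lemma log_series_integral_le (R : realType) (T delta x0 q : R)
    (F : R[i] -> R[i]) (K : nat) :
  0 < x0 -> 0 < delta -> 0 < q -> is_expsum F ->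
  (forall t, modC (F (0 +i* t)) <= 1) -> q <= modC (F (x0 +i* (T + delta / 2))) ->
  (\int[@lebesgue_measure R]_(t in `[T, (T + delta)%R])
     (2^-1 * log_series K (1 - modC (F (0 +i* t)) ^+ 2))%:E <=
   (pi * ((x0 ^+ 2 + delta ^+ 2 / 4) / x0) * - ln q)%:E)%E.
Proof.
move=> x0p d0 q0 hF F1 Fq.
have v01 t : 0 <= 1 - modC (F (0 +i* t)) ^+ 2 <= 1.
  by rewrite subr_ge0 expr_le1 ?modC_ge0 //= F1 gerBl sqr_ge0.
have hu := is_trig_log_series_modC K hF; set u := (fun t => _) in hu.
have u0 t : 0 <= u t.
  by rewrite mulr_ge0 // log_series_ge0 //; have /andP[] := v01 t.
apply: le_trans (integral_le_poisson_mean T x0p d0 hu u0) _.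
rewrite lee_fin; apply: ler_wpM2l.
  rewrite mulr_ge0 ?pi_ge0 // divr_ge0 ?ltW // ltr_pwDl ?exprn_gt0 //.
  by rewrite divr_ge0 // sqr_ge0.
have Fu t : modC (F (0 +i* t)) * expR (u t) <= 1.
  rewrite -ler_sqr ?nnegrE ?mulr_ge0 ?modC_ge0 ?expR_ge0 // exprMn -expRM_natl.
  rewrite /u mulrA divff // mul1r expr1n.
  by have := log_series_expR K (v01 t); rewrite opprB addrC subrK.
have h := jensen (T + delta / 2) (ltW x0p) hF hu u0 Fu.
set r := poisson_mean _ _ _ in h *.
have : q * expR r <= 1.
  by apply: le_trans h; apply: ler_wpM2r => //; exact: expR_ge0.
rewrite -{1}(lnK q0) -expRD expR_le1; lra.
Qed.

(** * Integrals, lower limits and complex series *)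

(** The integral of a nonnegative function is a supremum over the simple
    functions below it, and this set of simple functions grows with the
    function. *)
Lemma ge0_le_integral_nonmeasurable d (T : measurableType d) (R : realType)
    (mu : {measure set T -> \bar R}) (D : set T) (f g : T -> \bar R) :
  (forall x, D x -> 0 <= f x)%E -> (forall x, D x -> f x <= g x)%E ->
  (\int[mu]_(x in D) f x <= \int[mu]_(x in D) g x)%E.
Proof.
move=> f0 fg; rewrite !ge0_integralE //; last first.
  by move=> x Dx; exact: le_trans (f0 x Dx) (fg x Dx).
apply: ge_ereal_sup => _ [h hf <-]; apply: ereal_sup_ubound; exists h => // x.
apply: le_trans (hf x) _; rewrite !patchE; case: ifPn => // /set_mem; exact: fg.
Qed.

Lemma limn_einf_ge (R : realType) (u : (\bar R)^nat) (x : \bar R) (n : nat) :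
  (forall m, (n <= m)%N -> x <= u m)%E -> (x <= limn_einf u)%E.
Proof.
move=> h; rewrite limn_einf_lim (cvg_lim _ (@cvg_einfs_sup _ u)) //.
apply: le_trans (_ : einfs u n <= _)%E; last by apply: ereal_sup_ubound; exists n.
by apply: le_ereal_inf_tmp => _ [m /= nm <-]; exact: h.
Qed.

Lemma limn_einf_le (R : realType) (u : (\bar R)^nat) (x : \bar R) :
  (forall n, u n <= x)%E -> (limn_einf u <= x)%E.
Proof.
move=> h; rewrite limn_einf_lim (cvg_lim _ (@cvg_einfs_sup _ u)) //.
apply: ge_ereal_sup => _ [n _ <-]; apply: le_trans (h n).
by apply: ereal_inf_lbound; exists n => /=.
Qed.

(** Convergence in [R[i]^o] is tested against positive elements of [R[i]], which
    are the positive reals. *)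
Lemma cvg_complex (R : realType) (z : nat -> R[i]) (l : R[i]) :
  (fun n => modC (z n - l)) @ \oo --> (0 : R) ->
  (z : nat -> R[i]^o) @ \oo --> (l : R[i]^o).
Proof.
move=> h; apply/cvgrPdist_lt => e e0.
have [r r0 er] : exists2 r : R, 0 < r & e = r%:C.
  exists (complex.Re e).
    by move: e0; rewrite ltcE /= => /andP[].
  by move: e0; rewrite ltcE /= => /andP[/eqP + _]; case: e => a b /= ->.
have /cvgrPdist_lt /(_ r r0) := h.
apply: filterS => n; rewrite sub0r normrN ger0_norm ?modC_ge0 // => hn.
by rewrite distrC -modC_norm er ltcR.
Qed.

(** Absolute convergence gives convergence of the real and imaginary parts
    separately. *)
Lemma series_complex_bounded (R : realType) (z : nat -> R[i]) (b : nat -> R)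
    (M : R) :
  (forall n, modC (z n) <= b n) -> (forall n, \sum_(k < n) b k <= M) ->
  (fun n => modC (series z n - limn (series (z : nat -> R[i]^o))))
    @ \oo --> (0 : R).
Proof.
move=> zb bM.
have b0 n : 0 <= b n := le_trans (modC_ge0 _) (zb n).
have cb : cvgn (series b).
  apply: nondecreasing_is_cvgn.
    by apply/nondecreasing_seqP => n; rewrite /series /= big_nat_recr //= lerDl.
  by exists M => _ [n _ <-]; rewrite /series /= big_mkord.
have c1 (f : nat -> R) : (forall n, `|f n| <= b n) -> cvgn (series f).
  move=> fb; apply: normed_cvg; apply: (series_le_cvg _ b0 fb cb) => n.
  exact: normr_ge0.
have cRe : cvgn (series (fun n => complex.Re (z n))).
  by apply: c1 => n; exact: le_trans (ler_Re_modC _) (zb n).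
have cIm : cvgn (series (fun n => complex.Im (z n))).
  by apply: c1 => n; exact: le_trans (ler_Im_modC _) (zb n).
set x := limn _ in cRe; set y := limn _ in cIm.
have sRe n : complex.Re (series z n) = series (fun n => complex.Re (z n)) n.
  by rewrite /series /= Re_sum.
have sIm n : complex.Im (series z n) = series (fun n => complex.Im (z n)) n.
  by rewrite /series /= Im_sum.
have lim0 : (fun n => modC (series z n - (x +i* y))) @ \oo --> (0 : R).
  apply: (@squeeze_cvgr _ _ _ _ (fun=> 0)
    (fun n => `|series (fun n => complex.Re (z n)) n - x| +
              `|series (fun n => complex.Im (z n)) n - y|)).
  - apply: nearW => n; rewrite modC_ge0 /= -sRe -sIm.
    case: (series z n) => a c; rewrite modCE /=.
    rewrite -ler_sqr ?nnegrE ?sqrtr_ge0 ?addr_ge0 //.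
    rewrite sqr_sqrtr ?addr_ge0 ?sqr_ge0 //.
    rewrite -!(real_normK (num_real (_ - _))).
    have := normr_ge0 (a - x); have := normr_ge0 (c - y); nra.
  - exact: cvg_cst.
  - rewrite -[X in _ --> X]addr0 -{1}(normr0 R) -[X in _ --> _ + X](normr0 R).
    apply: cvgD; apply: cvg_norm; apply/subr_cvg0; [exact: cRe|exact: cIm].
rewrite (cvg_lim _ (cvg_complex lim0)) //; exact: norm_hausdorff.
Qed.

(** * Absolutely convergent Dirichlet series on a line *)

(** The line is moved to the imaginary axis by absorbing [exp (- lambda_n sigma)]
    into the coefficients [c]. *)
Section BoundedSeries.
Variables (R : realType) (c : nat -> R[i]) (lam : nat -> R) (N : R).
Hypotheses (lamP : dirichlet_exponents lam) (c0 : c 0%N = 1).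
Hypothesis cN : forall n, \sum_(k < n) modC (c k) <= N.
Local Notation mu := (@lebesgue_measure R).

Let term (s : R[i]) (n : nat) : R[i] := c n * expC (- (lam n)%:C * s).
Let L (t : R) : R[i] := limn (series (term (0 +i* t) : nat -> R[i]^o)).

Lemma exponents_ge k : lam 1%N <= lam k.+1.
Proof.
elim: k => // k IH; apply: le_trans IH _; exact: ltW (lamP.2 _).
Qed.

Lemma exponents1_gt0 : 0 < lam 1%N.
Proof. by have [<- h] := lamP; exact: h. Qed.

Lemma exponents_ge0 k : 0 <= lam k.
Proof.
case: k => [|k]; first by rewrite lamP.1.
exact: le_trans (ltW exponents1_gt0) (exponents_ge k).
Qed.

Lemma bound_ge1 : 1 <= N.
Proof. by have := cN 1; rewrite big_ord1 c0 modC1. Qed.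

Lemma modC_term t n : modC (term (0 +i* t) n) = modC (c n).
Proof.
by rewrite /term modCM modC_expC /= mulr0 sub0r oppr0 mul0r oppr0 expR0 mulr1.
Qed.

Lemma modC_partial_le t n : modC (series (term (0 +i* t)) n) <= N.
Proof.
rewrite /series /= big_mkord; apply: le_trans (modC_sum _ _ _) _.
by under eq_bigr do rewrite modC_term; exact: cN.
Qed.

Lemma partial_cvg t :
  (fun n => modC (series (term (0 +i* t)) n)) @ \oo --> modC (L t).
Proof.
have zb n : modC (term (0 +i* t) n) <= modC (c n) by rewrite modC_term.
have h := series_complex_bounded zb cN.
apply/cvgrPdist_lt => e e0; have /cvgrPdist_lt /(_ e e0) := h.
apply: filterS => n; rewrite sub0r normrN ger0_norm ?modC_ge0 //.
apply: le_lt_trans; rewrite distrC -/(L t) ler_norml.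
set S := series _ n.
have h1 := modCB S (- L t); have h2 := modCB (L t) (- S).
have h3 : modC (L t - S) = modC (S - L t) by rewrite -modCN opprB.
move: h1 h2; rewrite !modCN h3 => h1 h2.
by apply/andP; split; lra.
Qed.

Lemma modC_lim_le t : modC (L t) <= N.
Proof.
rewrite -(cvg_lim (@Rhausdorff R) (@partial_cvg t)); apply: limr_le.
  by apply/cvg_ex; eexists; exact: partial_cvg.
by apply: nearW => n; exact: modC_partial_le.
Qed.

Lemma integral_logp (T delta : R) : 0 < delta ->
  (\int[mu]_(t in `[T, (T + delta)%R]) logp (modC (L t)) <=
   (delta * ln N)%:E)%E.
Proof.
move=> d0; have N1 := bound_ge1; have N0 : 0 < N := lt_le_trans ltr01 N1.
apply: le_trans (_ : \int[mu]_(t in `[T, (T + delta)%R]) (cst (ln N)%:E) t <= _)%E.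
  apply: ge0_le_integral_nonmeasurable => t _; first by rewrite /logp le_max lexx.
  rewrite /logp ge_max lee_fin ln_ge0 // andTb.
  have [L0|L0] := leP (modC (L t)) 0.
    by rewrite le0_lneNy ?leNye // lee_fin.
  by rewrite lne_EFin // lee_fin ler_ln ?posrE // modC_lim_le.
rewrite integral_cst //= lebesgue_measure_itv /= lte_fin ltrDl d0.
by rewrite -EFinD -EFinM addrAC subrr add0r mulrC.
Qed.

Let F n (s : R[i]) : R[i] := (N^-1)%:C * series (term s) n.+1.

Lemma is_expsum_F n : is_expsum (F n).
Proof.
apply: is_expsumM; first exact: is_expsum_cst.
elim: n.+1 => [|m [l l0 IH]].
  have [l l0 h] := @is_expsum_cst R 0; exists l => // s.
  by rewrite -h /series /= big_geq.
have [l' l0' h] := is_expsumD (ex_intro2 _ _ l l0 IH)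
  (is_expsum_monomial (c m) (exponents_ge0 m)).
by exists l' => // s; rewrite -h /series /= big_nat_recr.
Qed.

Lemma modC_F n s : modC (F n s) = modC (series (term s) n.+1) / N.
Proof.
by rewrite /F modCM modC_real ?invr_ge0 ?(le_trans ler01 bound_ge1) // mulrC.
Qed.

(** [x0] is chosen so that [exp (- lam 1 * x0) = 1 / (2 N)]: all terms but the
    constant one have frequency at least [lam 1], hence their total modulus is
    at most [(N - 1) / (2 N) <= 1 / 2]. *)
Lemma modC_F_ge n (x0 t0 : R) : x0 = (ln N + ln 2) / lam 1%N ->
  (2 * N)^-1 <= modC (F n (x0 +i* t0)).
Proof.
move=> x0E; have l1 := exponents1_gt0.
have N1 := bound_ge1; have N0 : 0 < N := lt_le_trans ltr01 N1.
have x00 : 0 <= x0.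
  by rewrite x0E divr_ge0 ?(ltW l1) // addr_ge0 // ln_ge0 // ler1n.
have eN : expR (- (lam 1%N * x0)) = (2 * N)^-1.
  rewrite x0E mulrC divfK ?lt0r_neq0 // expRN expRD !lnK ?posrE //.
  by rewrite mulrC.
rewrite modC_F invfM ler_pM2r ?invr_gt0 //.
rewrite /series /= big_mkord big_ord_recl /=.
have -> : term (x0 +i* t0) 0%N = 1.
  by rewrite /term c0 lamP.1 (_ : (0 : R)%:C = 0) // oppr0 mul0r mul1r
    /expC /= expR0 cos0 sin0 mul1r.
apply: le_trans (modCB _ _); rewrite modC1.
suff : modC (\sum_(i < n) term (x0 +i* t0) (bump 0 i)) <= 2^-1 by lra.
apply: le_trans (modC_sum _ _ _) _.
apply: le_trans (_ : \sum_(i < n) modC (c i.+1) * (2 * N)^-1 <= _).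
  apply: ler_sum => i _; rewrite /term modCM modC_expC -eN.
  apply: ler_wpM2l; first exact: modC_ge0.
  rewrite ler_expR /= oppr0 mul0r subr0 mulNr lerN2; apply: ler_wpM2r => //.
  exact: exponents_ge.
rewrite -mulr_suml.
have : \sum_(i < n) modC (c i.+1) <= N - 1.
  by have := cN n.+1; rewrite big_ord_recl /= c0 modC1 => h; rewrite lerBrDl.
move=> h; rewrite invfM mulrCA -[leRHS]mulr1.
apply: ler_wpM2l; first by rewrite invr_ge0.
by rewrite ler_pdivrMr // mul1r; lra.
Qed.

(** For fixed [K], the [n]-th term is at least the [K]-th partial sum at
    [1 - |F n|^2] as soon as [n >= K]; so the lower limit dominates every
    partial sum at [1 - (|L| / N)^2], hence [- ln (|L| / N)]. *)
Lemma logm_le_limn_einf (t : R) :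
  (logm (modC (L t)) <=
   limn_einf (fun n =>
     (2^-1 * log_series n (1 - modC (F n (0 +i* t)) ^+ 2))%:E))%E.
Proof.
have N1 := bound_ge1; have N0 : 0 < N := lt_le_trans ltr01 N1.
pose m := modC (L t) / N.
have m0 : 0 <= m by rewrite divr_ge0 ?modC_ge0 // ltW.
have m1 : m <= 1 by rewrite ler_pdivrMr // mul1r modC_lim_le.
have v01 : 0 <= 1 - m ^+ 2 <= 1 by rewrite subr_ge0 expr_le1 // m1 gerBl sqr_ge0.
have F01 n : 0 <= 1 - modC (F n (0 +i* t)) ^+ 2.
  rewrite subr_ge0 expr_le1 ?modC_ge0 // modC_F ler_pdivrMr // mul1r.
  exact: modC_partial_le.
set l := limn_einf _.
have l0 : (0 <= l)%E.
  apply: (@limn_einf_ge _ _ _ 0%N) => n _.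
  by rewrite lee_fin mulr_ge0 // log_series_ge0.
have : forall K (r : R), l = r%:E -> log_series K (1 - m ^+ 2) <= 2 * r.
  move=> K r lr; apply/ler_addgt0Pr => e e0.
  have cF : (fun n => log_series K (1 - modC (F n (0 +i* t)) ^+ 2)) @ \oo -->
      log_series K (1 - m ^+ 2).
    have cm : (fun n => modC (F n (0 +i* t))) @ \oo --> m.
      under eq_fun do rewrite modC_F.
      apply: cvgM; last exact: cvg_cst.
      have := @partial_cvg t; rewrite -(cvg_shiftS _ _).
      by [].
    have cm2 : (fun n => 1 - modC (F n (0 +i* t)) ^+ 2) @ \oo --> 1 - m ^+ 2.
      by apply: cvgB; [exact: cvg_cst|exact: cvgM].
    exact: (@cvg_comp _ _ _ _ (log_series K) _ _ _ cm2
      (@continuous_log_series R K _)).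
  have /cvgrPdist_lt /(_ e e0) [n _ hn] := cF.
  suff : ((2^-1 * (log_series K (1 - m ^+ 2) - e))%:E <= l)%E.
    by rewrite lr lee_fin ler_pdivrMl // lerBlDr.
  apply: (@limn_einf_ge _ _ _ (maxn n K)) => j; rewrite geq_max => /andP[nj Kj].
  have := hn j nj; rewrite /= ltr_distlC => /andP[h _].
  rewrite lee_fin ler_pM2l ?invr_gt0 //.
  apply: le_trans (log_series_nd (F01 j) Kj).
  by move: h; lra.
case: l l0 => [r r0 hK|_ _|//]; last by rewrite leey.
have [v1 lr] := log_series_bounded v01 (fun K => hK K r erefl).
have mp : 0 < m.
  rewrite lt_neqAle m0 andbT eq_sym; apply/eqP => m00.
  by move: v1; rewrite m00; lra.
have Lp : 0 < modC (L t) by move: mp; rewrite pmulr_lgt0 // invr_gt0.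
rewrite /logm lne_EFin //.
have -> : (maxe 0 (- (ln (modC (L t)))%:E) = (Num.max 0 (- ln (modC (L t))))%:E)%E.
  by rewrite EFin_max.
rewrite lee_fin ge_max -lee_fin r0 /=.
move: lr; rewrite subKr lnXn // /m ln_div ?posrE //.
have := ln_ge0 N1; rewrite mulr2n; lra.
Qed.

(** Fatou's lemma, with the uniform bound of [log_series_integral_le] for
    [q = 1 / (2 N)]. The value obtained has [delta ^+ 2 / 4] in place of
    [delta ^+ 2]. *)
Lemma integral_logm (T delta : R) : 0 < delta ->
  (\int[mu]_(t in `[T, (T + delta)%R]) logm (modC (L t)) <=
   (pi * ((ln N + ln 2) ^+ 2 / lam 1%N + delta ^+ 2 * lam 1%N))%:E)%E.
Proof.
move=> d0; have l1 := exponents1_gt0.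
have N1 := bound_ge1; have N0 : 0 < N := lt_le_trans ltr01 N1.
have ln2 : 0 < ln 2 :> R by rewrite ln_gt0 // ltr1n.
have w0 : 0 < ln N + ln 2 by rewrite ltr_wpDl // ln_ge0.
pose x0 := (ln N + ln 2) / lam 1%N.
have x00 : 0 < x0 by rewrite divr_gt0.
pose f n t := (2^-1 * log_series n (1 - modC (F n (0 +i* t)) ^+ 2))%:E.
have mI : measurable (`[T, T + delta]%classic : set R) by exact: measurable_itv.
have F1 n t : modC (F n (0 +i* t)) <= 1.
  by rewrite modC_F ler_pdivrMr // mul1r modC_partial_le.
set B := (pi * _)%R.
have hf n : (\int[mu]_(t in `[T, (T + delta)%R]) f n t <= B%:E)%E.
  have q0 : 0 < (2 * N)^-1 by rewrite invr_gt0 mulr_gt0.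
  apply: le_trans (log_series_integral_le n x00 d0 q0 (is_expsum_F n) (F1 n)
    (modC_F_ge _ _ erefl)) _.
  rewrite lee_fin lnV ?posrE ?mulr_gt0 // lnM ?posrE // opprK /B.
  rewrite -mulrA; apply: ler_wpM2l; first exact: pi_ge0.
  rewrite [leRHS](_ : _ =
     ((x0 ^+ 2 + delta ^+ 2 / 4) / x0) * (ln 2 + ln N)
       + 3 / 4 * (delta ^+ 2 * lam 1%N)); last first.
    rewrite /x0 [ln 2 + _]addrC; move: (ln N + ln 2) w0 (lam 1%N) l1 => w wp l lp.
    by field; rewrite !lt0r_neq0.
  by rewrite lerDl mulr_ge0 // mulr_ge0 ?sqr_ge0 // ltW.
apply: le_trans (_ : \int[mu]_(t in `[T, (T + delta)%R]) limn_einf (f ^~ t) <= _)%E.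
  apply: ge0_le_integral_nonmeasurable => t _; last exact: logm_le_limn_einf.
  by rewrite /logm le_max lexx.
apply: (le_trans (@fatou _ _ _ mu _ mI f _ _)).
- move=> n; apply/measurable_EFinP; apply: measurable_funTS.
  apply: continuous_measurable_fun.
  exact: is_trig_continuous (is_trig_log_series_modC n (is_expsum_F n)).
- move=> n t _; rewrite lee_fin mulr_ge0 // log_series_ge0 //.
  by rewrite subr_ge0 expr_le1 ?modC_ge0.
- exact: limn_einf_le.
Qed.

End BoundedSeries.

Lemma expC_real (R : realType) (x : R) : expC x%:C = (expR x)%:C.
Proof. by rewrite /expC /= cos0 sin0 mulr1. Qed.

Lemma dirichlet_series_line (R : realType) (sigma : R) (a : nat -> R[i])
    (lambda : nat -> R) (t : R) :
  dirichlet_series a lambda (sigma +i* t) =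
  limn (series (fun n => (a n * (expR (- lambda n * sigma))%:C)
                         * expC (- (lambda n)%:C * (0 +i* t)) : R[i]^o)).
Proof.
rewrite /dirichlet_series.
suff -> : (fun n => a n * expC (- (lambda n)%:C * (sigma +i* t))) =
    (fun n => (a n * (expR (- lambda n * sigma))%:C)
              * expC (- (lambda n)%:C * (0 +i* t))) by [].
apply/funext => n; rewrite -mulrA -expC_real -expCD; congr (_ * expC _).
by apply/eqP; rewrite eq_complex /=; apply/andP; split; apply/eqP; ring.
Qed.

Lemma partial_norm1_le (R : realType) (sigma : R) (a : nat -> R[i])
    (lambda : nat -> R) (n : nat) :
  absolutely_convergent_on a lambda sigma ->
  \sum_(k < n) modC (a k * (expR (- lambda k * sigma))%:C) <=
  fine (dirichlet_norm1 a lambda sigma).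
Proof.
move=> hconv.
have pos k : (0 <= (modC (a k) * expR (- lambda k * sigma))%:E)%E.
  by rewrite lee_fin mulr_ge0 ?modC_ge0 ?expR_ge0.
rewrite -lee_fin fineK; last first.
  by rewrite ge0_fin_numE //; apply: nneseries_ge0 => k _ _; exact: pos.
apply: le_trans (nneseries_lim_ge n _); last by move=> k _ _; exact: pos.
rewrite sumEFin lee_fin big_mkord; apply: ler_sum => k _.
by rewrite modCM modC_real ?expR_ge0.
Qed.

(** * Logarithmic integrals of a Dirichlet series *)
Theorem theorem15 (R : realType) (sigma : R) (a : nat -> R[i])
    (lambda : nat -> R)
    (hlambda : dirichlet_exponents lambda)
    (hconv : absolutely_convergent_on a lambda sigma)
    (ha0 : a 0%N = 1) :
  forall T delta : R, 0 < delta ->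
  let N := fine (dirichlet_norm1 a lambda sigma) in
  (\int[@lebesgue_measure R]_(t in `[T, (T + delta)%R])
     logm (modC (dirichlet_series a lambda (sigma +i* t)%C))
   <= (pi * ((ln N + ln 2) ^+ 2 / lambda 1%N + delta ^+ 2 * lambda 1%N))%:E)%E
  /\
  (\int[@lebesgue_measure R]_(t in `[T, (T + delta)%R])
     logp (modC (dirichlet_series a lambda (sigma +i* t)%C))
   <= (delta * ln N)%:E)%E.
Proof.
move=> T delta d0 N.
have c0 : a 0%N * (expR (- lambda 0%N * sigma))%:C = 1.
  by rewrite ha0 hlambda.1 oppr0 mul0r expR0 mul1r.
have cN n := @partial_norm1_le R sigma a lambda n hconv.
split.
- under eq_integral do rewrite dirichlet_series_line.
  exact: (integral_logm hlambda c0 cN).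
- under eq_integral do rewrite dirichlet_series_line.
  exact: (integral_logp lambda c0 cN).
Qed.
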